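(* Let $X\subseteq\mathbb R^n$ be convex and compact, let $F(\mathbf x)=\mathbb E_\xi[f(\mathbf x;\xi)]$ be convex, $F^*=\min_{\mathbf x\in X}F(\mathbf x)$, and $D_\infty=\max_{\mathbf x,\mathbf y\in X}\|\mathbf x-\mathbf y\|_\infty$. Let $\{\mathbf x^{(k)}\}$ be generated by the algorithm APAM (see context) with step sizes $\{\alpha_k\}$ and without delay, i.e. $\widehat{\mathbf x}^{(k)}=\mathbf x^{(k)}$ for all $k\ge1$. Assume: (i) there is a finite $G_1$ with $\mathbb E_\xi\|\tilde\nabla f(\mathbf x;\xi)\|_1\le G_1$ for all $\mathbf x\in X$; (ii) there is a finite $G_\infty$ such that, almost surely in $\xi$, $\|\tilde\nabla f(\mathbf x;\xi)\|_\infty\le G_\infty$ for all $\mathbf x\in X$; (iii) $\mathbb E[\mathbf g^{(k)}\mid\mathcal H_k]\in\partial F(\widehat{\mathbf x}^{(k)})$ for every $k\ge 1$, where $\mathcal H_k$ is the $\sigma$-algebra generated by $\{\mathbf x^{(t)}\}_{t\le k}$. Given an integer $K>0$, let $$\bar{\mathbf x}^{(K)}=\sum_{k=1}^K\frac{\sum_{j=k}^K\alpha_j\beta_1^{j-k}}{\sum_{t=1}^K\left(\sum_{j=t}^K\alpha_j\beta_1^{j-t}\right)}\,\mathbf x^{(k)} .$$ Then: 1. If $\alpha_k=\frac{\alpha}{\sqrt K}$ for all $k\ge1$, for some $\alpha>0$, then $$\mathbb E\big[F(\bar{\mathbf x}^{(K)})-F^*\big]\le\frac{nD_\infty^2G_\infty+\frac{\alpha^2}{(1-\beta_1)^2}\frac{G_1}{\sqrt{1-\beta_2}}}{2\alpha\sqrt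 K(1-\beta_1)} .$$ 2. If $\alpha_k=\frac{\alpha}{\sqrt k}$ for all $k\ge1$, for some $\alpha>0$, then $$\mathbb E\big[F(\bar{\mathbf x}^{(K)})-F^*\big]\le\frac{nD_\infty^2G_\infty+\frac{\alpha^2(1+\log K)}{(1-\beta_1)^2}\frac{G_1}{\sqrt{1-\beta_2}}}{4\alpha(\sqrt{K+1}-1)(1-\beta_1)} .$$
   Context: Notation: $\tilde\nabla f(\mathbf x;\xi)$ denotes a subgradient of $f(\cdot;\xi)$ at $\mathbf x$ (the gradient if differentiable). $\oslash$ is component-wise division with the convention $0/0=0$; squares, square roots, powers and maxima of vectors are component-wise. For $\mathbf v\ge\mathbf 0$, $\|\mathbf x\|_{\mathbf v}^2=\mathbf x^\top\mathrm{Diag}(\mathbf v)\mathbf x$. Algorithm APAM: choose $\mathbf x^{(1)}\in X$, $\beta_1,\beta_2\in[0,1)$, step sizes $\alpha_k>0$; set $\mathbf m^{(0)}=\mathbf v^{(0)}=\widehat{\mathbf v}^{(0)}=\mathbf 0$. For $k=1,2,\dots$ obtain a stochastic (sub)gradient $\mathbf g^{(k)}$ and set $$\mathbf m^{(k)}=\beta_1\mathbf m^{(k-1)}+(1-\beta_1)\mathbf g^{(k)},\quad \mathbf v^{(k)}=\beta_2\mathbf v^{(k-1)}+(1-\beta_2)(\mathbf g^{(k)})^2,\quad \widehat{\mathbf v}^{(k)}=\max\{\widehat{\mathbf v}^{(k-1)},\mathbf v^{(k)}\},$$ $$\mathbf x^{(k+1)}\in\operatorname*{Arg\,min}_{\mathbf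 x\in X}\ \langle\mathbf m^{(k)},\mathbf x\rangle+\frac1{2\alpha_k}\|\mathbf x-\mathbf x^{(k)}\|^2_{\sqrt{\widehat{\mathbf v}^{(k)}}}.$$ Stochastic gradients: $\mathbf g^{(k)}=\frac1{b_k}\sum_{i=1}^{b_k}\tilde\nabla f(\widehat{\mathbf x}^{(k)};\xi_i^{(k)})$, where $b_k\ge1$ is the number of samples, $\widehat{\mathbf x}^{(k)}$ is the point at which the gradient is evaluated (here $\widehat{\mathbf x}^{(k)}=\mathbf x^{(k)}$), and the samples $\xi_i^{(k)}$ have the distribution of $\xi$ and are drawn independently of $\widehat{\mathbf x}^{(k)}$. *)

(* Defs.v *)
From HB Require Import structures.
From mathcomp Require Import all_boot all_order all_algebra.
From mathcomp Require Import all_classical all_reals all_analysis.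
Set Implicit Arguments.
Unset Strict Implicit.
Unset Printing Implicit Defensive.
Import Order.TTheory GRing.Theory Num.Theory.
Import numFieldNormedType.Exports.
Local Open Scope classical_set_scope.
Local Open Scope ring_scope.

(* Vectors of R^n are row vectors ['rV[R]_n]; the library norm [`|x|] on them
   is the sup norm (see [mx_normrE]). *)

Definition dotv (R : realType) (n : nat) (u v : 'rV[R]_n) : R :=
  \sum_(i < n) u 0 i * v 0 i.

Definition l1norm (R : realType) (n : nat) (u : 'rV[R]_n) : R :=
  \sum_(i < n) `|u 0 i|.

(* x^T Diag(v) x *)
Definition wnorm2 (R : realType) (n : nat) (v x : 'rV[R]_n) : R :=
  \sum_(i < n) v 0 i * x 0 i ^+ 2.

Definition argmin (R : realType) (T : Type) (A : set T) (h : T -> R) : set T :=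
  [set x | A x /\ forall y, A y -> h x <= h y].

Definition is_min_of (R : realType) (A : set R) (a : R) : Prop :=
  A a /\ lbound A a.

Definition is_max_of (R : realType) (A : set R) (a : R) : Prop :=
  A a /\ ubound A a.

Definition subdiff (R : realType) (n : nat) (h : 'rV[R]_n -> R)
    (x : 'rV[R]_n) : set 'rV[R]_n :=
  [set g | forall y, h x + dotv g (y - x) <= h y].

Definition is_gradient (R : realType) (n : nat) (h : 'rV[R]_n -> R)
    (x g : 'rV[R]_n) : Prop :=
  differentiable h x /\ forall v, 'd h x v = dotv g v.

(* A subgradient, which is the gradient at points of differentiability.  No
   convexity of [h] is presupposed: a differentiable nonconvex [h] is allowed. *)
Definition is_subgradient (R : realType) (n : nat) (h : 'rV[R]_n -> R)
    (x g : 'rV[R]_n) : Prop :=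
  is_gradient h x g \/ (~ differentiable h x /\ subdiff h x g).

(* R^n with its Borel sigma-algebra; convertible to ['rV[R]_n]. *)
Notation borelV R n := (g_sigma_algebraType (@open 'rV[R]_n)).

Section randomness.
Context (d : measure_display) (Omega : measurableType d) (R : realType).
Variable P : probability Omega R.

Definition independent_rv (d1 d2 : measure_display) (T1 : measurableType d1)
    (T2 : measurableType d2) (Y1 : Omega -> T1) (Y2 : Omega -> T2) : Prop :=
  forall A B, measurable A -> measurable B ->
    P (Y1 @^-1` A `&` Y2 @^-1` B) = (P (Y1 @^-1` A) * P (Y2 @^-1` B))%E.

(* [Z] is a version of E[Y | G], for a sub-sigma-algebra [G]. *)
Definition is_cond_exp (G : set (set Omega)) (Y Z : Omega -> R) : Prop :=
  [/\ forall B : set R, measurable B -> G (Z @^-1` B),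
      P.-integrable setT (EFin \o Z) &
      forall A, G A ->
        (\int[P]_(w in A) (Z w)%:E = \int[P]_(w in A) (Y w)%:E)%E].

Definition is_cond_expV (n : nat) (G : set (set Omega))
    (Y Z : Omega -> 'rV[R]_n) : Prop :=
  forall i : 'I_n, is_cond_exp G (fun w => Y w 0 i) (fun w => Z w 0 i).

(* The sigma-algebra generated by x^(1), ..., x^(k); the value at index 0 of a
   sequence of iterates is never used. *)
Definition history (n : nat) (x : nat -> Omega -> 'rV[R]_n) (k : nat) :
    set (set Omega) :=
  <<s \bigcup_(t in [set t | (1 <= t <= k)%N])
        g_sigma_algebra_preimage (x t : Omega -> borelV R n) >>.

End randomness.

Definition objective (d : measure_display) (Xi : measurableType d)
    (R : realType) (mu : probability Xi R) (n : nat)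
    (f : 'rV[R]_n -> Xi -> R) (x : 'rV[R]_n) : R :=
  fine 'E_mu[f x].

Section apam.
Variables (R : realType) (n : nat).
Implicit Types (g x : nat -> 'rV[R]_n) (X : set 'rV[R]_n).

Fixpoint apam_m (beta1 : R) g (k : nat) : 'rV[R]_n :=
  if k is j.+1 then beta1 *: apam_m beta1 g j + (1 - beta1) *: g k else 0.

Fixpoint apam_v (beta2 : R) g (k : nat) : 'rV[R]_n :=
  if k is j.+1 then
    beta2 *: apam_v beta2 g j + (1 - beta2) *: map_mx (fun c => c ^+ 2) (g k)
  else 0.

Fixpoint apam_vhat (beta2 : R) g (k : nat) : 'rV[R]_n :=
  if k is j.+1 then map2_mx Num.max (apam_vhat beta2 g j) (apam_v beta2 g k)
  else 0.

(* The sequence [x] is a run of the algorithm on the gradient sequence [g]. *)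
Definition apam X (beta1 beta2 : R) (alpha : nat -> R) g x : Prop :=
  X (x 1) /\
  forall k, (1 <= k)%N ->
    argmin X (fun y => dotv (apam_m beta1 g k) y +
        (2 * alpha k)^-1 *
          wnorm2 (map_mx Num.sqrt (apam_vhat beta2 g k)) (y - x k))
      (x k.+1).

(* sum_{j=k}^K alpha_j beta1^{j-k} *)
Definition avg_weight (beta1 : R) (alpha : nat -> R) (K k : nat) : R :=
  \sum_(k <= j < K.+1) alpha j * beta1 ^+ (j - k).

Definition weighted_avg (beta1 : R) (alpha : nat -> R) (K : nat) x : 'rV[R]_n :=
  \sum_(1 <= k < K.+1)
    (avg_weight beta1 alpha K k /
       \sum_(1 <= t < K.+1) avg_weight beta1 alpha K t) *: x k.

End apam.

Definition minibatch_grad (Omega Xi : Type) (R : realType) (n : nat)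
    (gradf : 'rV[R]_n -> Xi -> 'rV[R]_n) (b : nat -> nat)
    (xi : nat -> nat -> Omega -> Xi) (xhat : nat -> Omega -> 'rV[R]_n)
    (k : nat) (w : Omega) : 'rV[R]_n :=
  (b k)%:R^-1 *: \sum_(1 <= i < (b k).+1) gradf (xhat k w) (xi k i w).

(* Main.v *)
(* Put S = sqrt (1 - beta2), V_k = sqrt vhat_k, and w_k = avg_weight k, so that
   w_k = alpha_k + beta1 w_{k+1} and w_k <= alpha_k / (1 - beta1).  Abel
   summation in the momentum recursion turns (1 - beta1) sum_k w_k <g_k, x_k - x*>
   into sum_k alpha_k <m_k, x_{k+1} - x*> + w_k <m_k, x_k - x_{k+1}>.  The
   three-point inequality for the proximal step bounds the first term by the
   difference of the V_k-distances to x*, minus half the V_k-length of the step;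
   Young's inequality absorbs that length into the second term, at the cost of
   w_k^2 m_k^2 / (2 V_k).  The distances telescope to at most
   D^2 sum_i V_{K,i} / 2 because V_k is nondecreasing.  Coordinatewise
   S |g_j| <= V_k for j <= k, hence m_k^2 / V_k is at most 1/S times the
   exponential average of the |g_j|, whose expected l1 norm is at most G1.
   Finally, E <g_k, x_k - x*> bounds E (F x_k - Fstar) since x_k is measurable with
   respect to the history, and Jensen's inequality passes to the average.

   No measurability of F along the iterates is available, so expectations of
   F-gaps are only compared as integrals of nonnegative functions. *)

Require Import Defs.
From HB Require Import structures.
From mathcomp Require Import all_boot all_order all_algebra.
From mathcomp Require Import all_classical all_reals all_analysis.
From mathcomp Require Import measurable_realfun.
From mathcomp Require Import ring lra.
Set Implicit Arguments.
Unset Strict Implicit.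
Unset Printing Implicit Defensive.
Import Order.TTheory GRing.Theory Num.Theory.
Import numFieldNormedType.Exports.
Local Open Scope classical_set_scope.
Local Open Scope ring_scope.

(** * Pathwise analysis: proximal step, moment estimates and regret of a single run *)

Section deterministic.
Variables (R : realType) (n : nat).
Implicit Types (u v x y z : 'rV[R]_n) (g : nat -> 'rV[R]_n).

Lemma dotvDl u v x : dotv (u + v) x = dotv u x + dotv v x.
Proof. by rewrite -big_split; apply: eq_bigr => i _; rewrite mxE mulrDl. Qed.

Lemma dotvZl a u x : dotv (a *: u) x = a * dotv u x.
Proof. by rewrite mulr_sumr; apply: eq_bigr => i _; rewrite mxE mulrA. Qed.

Lemma dotvDr u x y : dotv u (x + y) = dotv u x + dotv u y.
Proof. by rewrite -big_split; apply: eq_bigr => i _; rewrite mxE mulrDr. Qed.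

Lemma dotvZr a u x : dotv u (a *: x) = a * dotv u x.
Proof. by rewrite mulr_sumr; apply: eq_bigr => i _; rewrite mxE mulrCA. Qed.

Lemma dotvBr u x y : dotv u (x - y) = dotv u x - dotv u y.
Proof. by rewrite dotvDr -scaleN1r dotvZr mulN1r. Qed.

Lemma dot0v u : dotv 0 u = 0.
Proof. by rewrite /dotv big1// => i _; rewrite mxE mul0r. Qed.

Lemma normr_coord_le x i : `|x 0 i| <= `|x|.
Proof.
rewrite {2}/Num.norm/= mx_normrE.
exact: (le_bigmax _ (fun ij => `|x ij.1 ij.2|) (0, i)).
Qed.

Lemma convex_comb_in (A : set 'rV[R]_n) (x y : 'rV[R]_n) (t : R) :
  convex_set (A : set (convex_lmodType 'rV[R]_n)) -> A x -> A y ->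
  0 <= t -> t <= 1 -> A (t *: x + (1 - t) *: y).
Proof.
move=> cA Ax Ay t0 t1.
by have /set_mem := cA x y (Itv01 t0 t1) (mem_set Ax) (mem_set Ay).
Qed.

(** First-order optimality of [z] without derivatives: minimality is tested along the segment from
    [z] to [y], where the objective is quadratic in the parameter. The cross term [c] is then
    expressed by the three squared distances. *)
Lemma argmin_three_point (X : set 'rV[R]_n) (m v x y z : 'rV[R]_n) (a : R) :
  convex_set (X : set (convex_lmodType 'rV[R]_n)) -> 0 < a ->
  argmin X (fun y => dotv m y + (2 * a)^-1 * wnorm2 v (y - x)) z -> X y ->
  a * dotv m (z - y) <=
    2^-1 * (wnorm2 v (y - x) - wnorm2 v (y - z) - wnorm2 v (z - x)).
Proof.
move=> cX a0 [Xz zmin] Xy.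
pose c := \sum_i v 0 i * (z 0 i - x 0 i) * (y 0 i - z 0 i).
have expand t : wnorm2 v (t *: y + (1 - t) *: z - x) =
    wnorm2 v (z - x) + 2 * t * c + t ^+ 2 * wnorm2 v (y - z).
  rewrite /wnorm2 /c !mulr_sumr -!big_split/=; apply: eq_bigr => i _.
  by rewrite !mxE; ring.
have -> : wnorm2 v (y - x) - wnorm2 v (y - z) - wnorm2 v (z - x) = 2 * c.
  have := expand 1; rewrite scale1r subrr scale0r addr0 => ->; ring.
rewrite mulrA mulVf ?mul1r ?pnatr_eq0//.
(* Minimality against the point at parameter [t], divided by [t / a]; the right side is the
   second-order remainder. *)
have step (t : R) : 0 < t -> t <= 1 ->
    a * dotv m (z - y) - c <= t * (2^-1 * wnorm2 v (y - z)).
  move=> t0 t1.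
  have := zmin _ (convex_comb_in cX Xy Xz (ltW t0) t1).
  rewrite /= expand dotvBr dotvDr !dotvZr -subr_ge0.
  have -> : t * dotv m y + (1 - t) * dotv m z +
      (2 * a)^-1 * (wnorm2 v (z - x) + 2 * t * c + t ^+ 2 * wnorm2 v (y - z)) -
      (dotv m z + (2 * a)^-1 * wnorm2 v (z - x)) =
      t / a * (t * (2^-1 * wnorm2 v (y - z)) + c - a * (dotv m z - dotv m y)).
    by field; rewrite gt_eqF.
  by rewrite pmulr_rge0 ?divr_gt0//; lra.
rewrite -subr_le0; set l := _ - c in step *; set q := 2^-1 * _ in step.
(* The weights [v] carry no sign, so [q] may be nonpositive, and then [t = 1] suffices. Otherwise a
   positive [l] is refuted at [t = l / (l + q)], where the bound reads [l * (l + q) <= l * q]. *)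
have [q0|q0] := lerP q 0; first by have := step 1 ltr01 (lexx _); lra.
rewrite leNgt; apply/negP => l0.
have := step (l / (l + q)).
have lq : 0 < l + q by lra.
rewrite divr_gt0// ler_pdivrMr// mul1r lerDl (ltW q0) => /(_ isT isT).
rewrite mulrAC ler_pdivlMr// => h.
have : 0 < l * l by exact: mulr_gt0.
lra.
Qed.

Lemma apam_m_ge0 (b : R) g k i : 0 <= b <= 1 -> (forall j, 0 <= g j 0 i) ->
  0 <= apam_m b g k 0 i.
Proof.
move=> /andP[b0 b1] g0; elim: k => [|k IH]; rewrite /= !mxE//.
by rewrite addr_ge0// mulr_ge0// subr_ge0.
Qed.

Lemma apam_v_ge0 (b : R) g k i : 0 <= b <= 1 -> 0 <= apam_v b g k 0 i.
Proof.
move=> /andP[b0 b1]; elim: k => [|k IH]; rewrite /= !mxE//.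
by rewrite addr_ge0// mulr_ge0 ?subr_ge0// sqr_ge0.
Qed.

Lemma apam_vhat_nondecreasing (b : R) g i :
  {homo (fun k => apam_vhat b g k 0 i) : j k / (j <= k)%N >-> j <= k}.
Proof.
apply: homo_leq => [//|? ? ?|k]; first exact: le_trans.
by rewrite /= mxE le_max lexx.
Qed.

(** The term [(1 - b) * g j 0 i ^+ 2] is one of the two nonnegative summands of [apam_v] at [j], and
    [apam_vhat] dominates that value from [j] onwards. *)
Lemma normr_grad_le_sqrt_vhat (b : R) g j k i :
  0 <= b <= 1 -> (1 <= j <= k)%N ->
  Num.sqrt (1 - b) * `|g j 0 i| <= Num.sqrt (apam_vhat b g k 0 i).
Proof.
move=> b01 /andP[j1 jk]; have /andP[b0 b1] := b01.
rewrite -sqrtr_sqr -sqrtrM ?subr_ge0// ler_wsqrtr//.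
apply: le_trans (apam_vhat_nondecreasing b g i jk).
case: j j1 {jk} => // j _; rewrite /= !mxE le_max; apply/orP; right.
by rewrite lerDr mulr_ge0// apam_v_ge0.
Qed.

(** Starting from 0, [apam_v] averages squares bounded by [G ^+ 2]; the bound survives both
    averaging and maxima. *)
Lemma sqrt_vhat_le (b G : R) g k i : 0 <= b <= 1 -> 0 <= G ->
  (forall j, (1 <= j <= k)%N -> `|g j 0 i| <= G) ->
  Num.sqrt (apam_vhat b g k 0 i) <= G.
Proof.
move=> /andP[b0 b1] G0 gG.
suff vG j : (j <= k)%N -> apam_v b g j 0 i <= G ^+ 2 /\ apam_vhat b g j 0 i <= G ^+ 2.
  rewrite -(ger0_norm G0) -sqrtr_sqr ler_wsqrtr//.
  by have [] := vG k (leqnn k).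
elim: j => [|j IH] jk; first by rewrite !mxE sqr_ge0.
have [IHv IHh] := IH (ltnW jk).
have gj : g j.+1 0 i ^+ 2 <= G ^+ 2.
  by rewrite -[leLHS]real_normK ?num_real// lerXn2r ?nnegrE// gG.
have vj : apam_v b g j.+1 0 i <= G ^+ 2.
  rewrite /= !mxE.
  have h1 : b * apam_v b g j 0 i <= b * G ^+ 2 by exact: ler_wpM2l.
  have h2 : (1 - b) * g j.+1 0 i ^+ 2 <= (1 - b) * G ^+ 2.
    by apply: ler_wpM2l => //; rewrite subr_ge0.
  lra.
by split=> //=; rewrite mxE ge_max IHh.
Qed.

Lemma sqr_convex (b c d : R) : 0 <= b <= 1 ->
  (b * c + (1 - b) * d) ^+ 2 <= b * c ^+ 2 + (1 - b) * d ^+ 2.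
Proof.
move=> /andP[b0 b1]; rewrite -subr_ge0.
have -> : b * c ^+ 2 + (1 - b) * d ^+ 2 - (b * c + (1 - b) * d) ^+ 2 =
  b * (1 - b) * (c - d) ^+ 2 by ring.
by rewrite mulr_ge0 ?sqr_ge0// mulr_ge0// subr_ge0.
Qed.

(** Convexity of the square bounds the squared momentum by the exponential average of the squared
    gradients, and each square, times [S], is at most [V] times the absolute value. Since [V] is
    common to all [j], it factors out of the induction. *)
Lemma apam_m_sqr_le (b S V : R) g k i : 0 <= b <= 1 -> 0 <= S ->
  (forall j, (1 <= j <= k)%N -> S * `|g j 0 i| <= V) ->
  S * apam_m b g k 0 i ^+ 2 <= V * apam_m b (fun j => map_mx Num.norm (g j)) k 0 i.
Proof.
move=> b01 S0; have /andP[b0 b1] := b01.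
elim: k => [|k IH] gV; first by rewrite /= !mxE expr0n/= !mulr0.
rewrite /= !mxE; set q := apam_m _ (fun j => map_mx _ (g j)) _ _ _.
set m := apam_m _ g _ _ _.
set c := g k.+1 0 i.
have IH' : S * m ^+ 2 <= V * q.
  by apply: IH => j /andP[j1 jk]; apply: gV; rewrite j1 ltnW.
have h1 : S * (b * m + (1 - b) * c) ^+ 2 <= S * (b * m ^+ 2 + (1 - b) * c ^+ 2).
  by apply: ler_wpM2l => //; exact: sqr_convex.
have h2 : S * c ^+ 2 <= V * `|c|.
  by rewrite -(real_normK (num_real c)) expr2 mulrA ler_wpM2r// gV// ltnSn.
have h3 : b * (S * m ^+ 2) <= b * (V * q) by exact: ler_wpM2l.
have h4 : (1 - b) * (S * c ^+ 2) <= (1 - b) * (V * `|c|).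
  by apply: ler_wpM2l => //; rewrite subr_ge0.
lra.
Qed.

(** Completing the square gives [w * m * e <= V * e^2 / 2 + w^2 * m^2 / (2 * V)], and
    [m^2 / V <= q]. The form without division covers [V = 0], where the hypothesis forces
    [m = 0]. *)
Lemma weighted_young (m e V q w : R) : 0 <= V -> 0 <= q -> m ^+ 2 <= V * q ->
  w * (m * e) - 2^-1 * (V * e ^+ 2) <= 2^-1 * w ^+ 2 * q.
Proof.
move=> V0 q0 mVq.
have [V_eq0|V_gt0] := eqVneq V 0.
  have m0 : m = 0.
    apply/eqP; rewrite -sqrf_eq0 eq_le sqr_ge0 andbT (le_trans mVq)//.
    by rewrite V_eq0 mul0r.
  by rewrite V_eq0 m0 !mul0r !mulr0 subrr mulr_ge0// mulr_ge0// sqr_ge0.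
have {V_gt0} V_gt0 : 0 < V by rewrite lt_neqAle eq_sym V_gt0.
rewrite -(ler_pM2l V_gt0) -subr_ge0.
have -> : V * (2^-1 * w ^+ 2 * q) - V * (w * (m * e) - 2^-1 * (V * e ^+ 2)) =
  2^-1 * (w ^+ 2 * (V * q - m ^+ 2) + (w * m - V * e) ^+ 2) by field.
by rewrite mulr_ge0// addr_ge0 ?sqr_ge0// mulr_ge0 ?sqr_ge0// subr_ge0.
Qed.

(** Keeping the term in [u K.+1] closes the induction: [D - u K.+1] is nonnegative, so its factor
    [V K] may be raised to [V K.+1]. *)
Lemma telescope_le (V u : nat -> R) (D : R) K :
  (forall k, 0 <= V k) -> (forall k, V k <= V k.+1) ->
  (forall k, (1 <= k)%N -> u k <= D) ->
  \sum_(1 <= k < K.+1) V k * (u k - u k.+1) <= V K * (D - u K.+1).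
Proof.
move=> V0 Vnd uD; elim: K => [|K IH].
  by rewrite big_geq// mulr_ge0// subr_ge0 uD.
rewrite big_nat_recr//=.
have : V K * (D - u K.+1) <= V K.+1 * (D - u K.+1).
  by rewrite ler_wpM2r// subr_ge0 uD.
lra.
Qed.

(** Rests on [(1 - b) * g_k = m_k - b * m_(k-1)] with [m_0 = 0]. The weights are arbitrary; the last
    summand is the boundary term, which vanishes once [w K.+1 = 0]. *)
Lemma momentum_abel (b : R) (w : nat -> R) g (x : nat -> 'rV[R]_n) xs K :
  (1 - b) * (\sum_(1 <= k < K.+1) w k * dotv (g k) (x k - xs)) =
  \sum_(1 <= k < K.+1) ((w k - b * w k.+1) * dotv (apam_m b g k) (x k.+1 - xs)
     + w k * dotv (apam_m b g k) (x k - x k.+1))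
  + b * w K.+1 * dotv (apam_m b g K) (x K.+1 - xs).
Proof.
elim: K => [|K IH]; first by rewrite !big_geq// dot0v !mulr0 addr0.
rewrite !(big_nat_recr K.+1)//= mulrDr IH !dotvDl !dotvZl !dotvBr.
ring.
Qed.

(** * Averaging weights *)

Section weights.
Variables (b : R) (alpha : nat -> R) (K : nat).
Hypothesis b01 : 0 <= b < 1.
Hypothesis alpha_gt0 : forall k, (1 <= k)%N -> 0 < alpha k.
Notation w := (avg_weight b alpha K).

Lemma avg_weight_gtK k : (K < k)%N -> w k = 0.
Proof. by move=> Kk; rewrite /avg_weight big_geq. Qed.

Lemma avg_weightS k : (k <= K)%N -> w k = alpha k + b * w k.+1.
Proof.
move=> kK; rewrite /avg_weight big_ltn ?ltnS// subnn expr0 mulr1; congr (_ + _).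
rewrite mulr_sumr; apply: eq_big_nat => j /andP[kj _].
by rewrite -(subnSK kj) exprS; ring.
Qed.

Lemma avg_weight_ge0 k : (1 <= k)%N -> 0 <= w k.
Proof.
move=> k1; rewrite /avg_weight big_nat_cond sumr_ge0// => j /andP[/andP[kj _] _].
have /andP[b0 _] := b01.
by rewrite mulr_ge0 ?exprn_ge0// ltW// alpha_gt0// (leq_trans k1).
Qed.

Lemma avg_weight_ge k : (1 <= k <= K)%N -> alpha k <= w k.
Proof.
move=> /andP[k1 kK]; have /andP[b0 _] := b01.
by rewrite avg_weightS// lerDl mulr_ge0// avg_weight_ge0.
Qed.

(** Downward induction through [avg_weightS]: if [w k.+1 <= alpha k / (1 - b)], then [alpha k + b *
    w k.+1 <= alpha k / (1 - b)]. Beyond [K] the weight is 0, which starts the induction. *)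
Lemma avg_weight_le k : (forall j, (1 <= j)%N -> alpha j.+1 <= alpha j) ->
  (1 <= k)%N -> w k <= alpha k / (1 - b).
Proof.
move=> alpha_ni; have /andP[b0 b1] := b01; have b'0 : 0 < 1 - b by rewrite subr_gt0.
have [d] := ubnP (K.+1 - k)%N; elim: d k => // d IH k; rewrite ltnS => kd k1.
have [Kk|kK] := ltnP K k.
  by rewrite avg_weight_gtK// divr_ge0// ltW// alpha_gt0.
rewrite avg_weightS// ler_pdivlMr//.
have := IH k.+1; rewrite subSn// in kd; rewrite subSS => /(_ kd isT).
rewrite ler_pdivlMr// => IHk.
have : b * (w k.+1 * (1 - b)) <= b * alpha k.
  by rewrite ler_wpM2l// (le_trans IHk)// alpha_ni.
lra.
Qed.

End weights.

(** The right side keeps only quantities whose expectations can be controlled. [D] bounds the sup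
    norm, hence each coordinate separately, as the coordinatewise weights require. *)
Lemma apam_regret (X : set 'rV[R]_n) (beta1 beta2 : R) (alpha : nat -> R)
    g (x : nat -> 'rV[R]_n) xs (D : R) K :
  convex_set (X : set (convex_lmodType 'rV[R]_n)) ->
  0 <= beta1 < 1 -> 0 <= beta2 < 1 ->
  (forall k, (1 <= k)%N -> 0 < alpha k) ->
  apam X beta1 beta2 alpha g x -> X xs ->
  (forall y, X y -> `|y - xs| <= D) ->
  (1 - beta1) *
    (\sum_(1 <= k < K.+1) avg_weight beta1 alpha K k * dotv (g k) (x k - xs)) <=
  2^-1 * D ^+ 2 * (\sum_i Num.sqrt (apam_vhat beta2 g K 0 i)) +
  \sum_(1 <= k < K.+1) 2^-1 * avg_weight beta1 alpha K k ^+ 2 / Num.sqrt (1 - beta2) *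
    l1norm (apam_m beta1 (fun j => map_mx Num.norm (g j)) k).
Proof.
move=> cX b1 b2 alpha0 [Xx1 xmin] Xxs XD.
have Xx k : (1 <= k)%N -> X (x k) by case: k => // -[//|k] _; have [] := xmin k.+1 isT.
have b1' : 0 <= beta1 <= 1 by case/andP: b1 => -> /ltW ->.
have b2' : 0 <= beta2 <= 1 by case/andP: b2 => -> /ltW ->.
have S0 : 0 < Num.sqrt (1 - beta2) by rewrite sqrtr_gt0 subr_gt0; case/andP: b2.
set w := avg_weight _ _ _; set S := Num.sqrt (1 - beta2) in S0 *.
pose V k := map_mx Num.sqrt (apam_vhat beta2 g k).
have V0 k i : 0 <= V k 0 i by rewrite mxE sqrtr_ge0.
have wK : w K.+1 = 0 by exact: avg_weight_gtK.
rewrite momentum_abel wK mulr0 mul0r addr0.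
(* One iteration: the three-point inequality, with the step length absorbed coordinate by
   coordinate. *)
have step k : (1 <= k <= K)%N ->
  (w k - beta1 * w k.+1) * dotv (apam_m beta1 g k) (x k.+1 - xs) +
    w k * dotv (apam_m beta1 g k) (x k - x k.+1) <=
  2^-1 * (wnorm2 (V k) (xs - x k) - wnorm2 (V k) (xs - x k.+1)) +
  2^-1 * w k ^+ 2 / S * l1norm (apam_m beta1 (fun j => map_mx Num.norm (g j)) k).
  move=> /andP[k1 kK].
  have -> : w k - beta1 * w k.+1 = alpha k by rewrite /w avg_weightS// addrK.
  have := argmin_three_point cX (alpha0 _ k1) (xmin _ k1) Xxs; rewrite -/(V k).
  suff : w k * dotv (apam_m beta1 g k) (x k - x k.+1) -
      2^-1 * wnorm2 (V k) (x k.+1 - x k) <=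
      2^-1 * w k ^+ 2 / S * l1norm (apam_m beta1 (fun j => map_mx Num.norm (g j)) k).
    by set a := dotv _ _; lra.
  rewrite !mulr_sumr -sumrB ler_sum// => i _.
  set q := apam_m _ (fun j => map_mx _ (g j)) _.
  have q0 : 0 <= q 0 i by apply: apam_m_ge0 => // j; rewrite mxE.
  pose e := (x k - x k.+1) 0 i.
  have -> : (x k.+1 - x k) 0 i ^+ 2 = e ^+ 2 by rewrite /e !mxE; ring.
  rewrite (ger0_norm q0) -mulrA [S^-1 * _]mulrC.
  (* Young's inequality with [q 0 i / S] in the role of its [q]. *)
  apply: weighted_young; rewrite ?divr_ge0// ?(ltW S0)//.
  rewrite mulrA ler_pdivlMr// mulrC mxE.
  apply: apam_m_sqr_le => // [|j jk]; first exact: ltW.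
  exact: normr_grad_le_sqrt_vhat.
apply: le_trans (_ : \sum_(1 <= k < K.+1) _ <= _) _.
  by apply: ler_sum_nat => k; rewrite ltnS => kK; exact: step.
rewrite big_split/= lerD2r -mulr_sumr -mulrA ler_pM2l//.
(* The sums are exchanged because telescoping works per coordinate: each [V k 0 i] is nondecreasing
   in [k]. *)
rewrite (eq_bigr (fun k => \sum_i
    V k 0 i * ((xs - x k) 0 i ^+ 2 - (xs - x k.+1) 0 i ^+ 2))); last first.
  by move=> k _; rewrite -sumrB; apply: eq_bigr => i _; rewrite mulrBr.
rewrite exchange_big/= mulr_sumr; apply: ler_sum => i _.
pose u k := (xs - x k) 0 i ^+ 2.
have uD k : (1 <= k)%N -> u k <= D ^+ 2.
  move=> k1; have D0 : `|(xs - x k) 0 i| <= D.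
    by rewrite (le_trans (normr_coord_le _ _))// distrC; exact/XD/Xx.
  by rewrite /u -[leLHS]real_normK ?num_real// lerXn2r ?nnegrE// (le_trans _ D0).
apply: le_trans (telescope_le (V := fun k => V k 0 i) _ _ _ uD) _ => //.
- by move=> k; rewrite !mxE ler_wsqrtr// le_max lexx.
- by rewrite mulrC mxE ler_wpM2r// ?sqrtr_ge0// gerBl sqr_ge0.
Qed.

End deterministic.

(** * Jensen's inequality for weighted means, and sums of step sizes *)

Section averages.
Variables (R : realType) (n : nat).

(** Induction on the number of points; letting the indices run up to [K.+1] guarantees at least one
    point, hence a positive total weight. *)
Lemma jensen_weighted_mean (X : set 'rV[R]_n) (F : 'rV[R]_n -> R)
    (c : nat -> R) (x : nat -> 'rV[R]_n) K :
  convex_set (X : set (convex_lmodType 'rV[R]_n)) ->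
  convex_function ([set: 'rV[R]_n] : set (convex_lmodType 'rV[R]_n)) F ->
  (forall k, (1 <= k <= K.+1)%N -> 0 < c k) ->
  (forall k, (1 <= k <= K.+1)%N -> X (x k)) ->
  let W := \sum_(1 <= t < K.+2) c t in
  let y := \sum_(1 <= k < K.+2) (c k / W) *: x k in
  X y /\ F y <= (\sum_(1 <= k < K.+2) c k * F (x k)) / W.
Proof.
move=> cX cF; elim: K => [|K IH] c0 Xx /=.
  have c10 : c 1 != 0 by rewrite gt_eqF// c0.
  rewrite !big_nat1 divff// scale1r mulrAC divff// mul1r lexx.
  by split=> //; apply: Xx.
have sub k : (1 <= k <= K.+1)%N -> (1 <= k <= K.+2)%N.
  by move=> /andP[-> /= kK]; rewrite ltnW.
have [Xy Fy] := IH (fun k kK => c0 k (sub k kK)) (fun k kK => Xx k (sub k kK)).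
rewrite !(big_nat_recr K.+2)//=.
set W := \sum_(1 <= t < K.+2) c t in Xy Fy *.
set y := \sum_(1 <= k < K.+2) (c k / W) *: x k in Xy Fy.
set s := c K.+2; have s0 : 0 < s by apply: c0; rewrite leqnn.
have W0 : 0 < W.
  rewrite /W big_ltn// ltr_wpDr ?c0//.
  rewrite big_nat_cond sumr_ge0// => k /andP[/andP[k1 kK] _].
  by rewrite ltW// c0// (ltnW k1)/= ltnW.
have Ws0 : 0 < W + s by exact: addr_gt0.
have Ws : 1 - W / (W + s) = s / (W + s) by field; rewrite gt_eqF.
have t0 : 0 <= W / (W + s) by rewrite divr_ge0// ltW.
have t1 : W / (W + s) <= 1 by rewrite ler_pdivrMr// mul1r lerDl ltW.
(* A new point rescales the old mean by [W / (W + s)], so the new mean is a convex combination of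
   two points. *)
have -> : \sum_(1 <= k < K.+2) (c k / (W + s)) *: x k + (s / (W + s)) *: x K.+2 =
    (W / (W + s)) *: y + (1 - W / (W + s)) *: x K.+2.
  rewrite Ws; congr (_ + _); rewrite scaler_sumr; apply: eq_bigr => k _.
  by rewrite scalerA; congr (_ *: _); field; rewrite !gt_eqF.
have Xs : X (x K.+2) by apply: Xx; rewrite leqnn.
split; first exact: convex_comb_in.
have := cF (Itv01 t0 t1) y (x K.+2) (mem_set I) (mem_set I).
rewrite -[X in _ <= X]/(W / (W + s) * F y + (1 - W / (W + s)) * F (x K.+2)).
move=> /le_trans; apply.
rewrite Ws mulrDl -[s * _ / _]mulrAC lerD2r.
rewrite ler_pdivlMr//.
have -> : W / (W + s) * F y * (W + s) = F y * W by field; rewrite gt_eqF.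
by rewrite -ler_pdivlMr.
Qed.

(** The increment of the logarithm from [K+1] to [K+2] is [- ln (1 - 1/(K+2))], at least [1/(K+2)]
    by [ln (1 + x) <= x]. *)
Lemma sum_inv_le_1Dln K : (0 < K)%N ->
  \sum_(1 <= k < K.+1) (k%:R : R)^-1 <= 1 + ln (K%:R : R).
Proof.
case: K => // K _; elim: K => [|K IH].
  by rewrite big_nat1 invr1 ln1 addr0.
rewrite big_nat_recr//=.
have K1 : 0 < (K.+1%:R : R) by rewrite ltr0n.
have K2 : 0 < (K.+2%:R : R) by rewrite ltr0n.
have -> : ln (K.+2%:R : R) = ln K.+1%:R + - ln (K.+1%:R / K.+2%:R).
  by rewrite ln_div ?posrE//; ring.
suff h : ln (K.+1%:R / K.+2%:R : R) <= - K.+2%:R^-1.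
  by rewrite addrA lerD// lerNr.
have -> : (K.+1%:R / K.+2%:R : R) = 1 + - K.+2%:R^-1.
  rewrite -[X in X / _ = _](addrK 1) natr1 mulrBl mul1r divff// gt_eqF.
by apply: le_ln1Dx; rewrite ltrN2 invf_lt1// ltr1n.
Qed.

(** Consecutive roots [a], [b] satisfy [b^2 - a^2 = 1], so the increment bound
    [2 * a * (b - a) <= 1] amounts to [(b - a)^2 >= 0]. *)
Lemma sum_inv_sqrt_ge K :
  2 * (Num.sqrt K.+1%:R - 1) <= \sum_(1 <= k < K.+1) (Num.sqrt (k%:R : R))^-1.
Proof.
elim: K => [|K IH]; first by rewrite big_geq// sqrtr1 subrr mulr0.
rewrite big_nat_recr//=.
set a := Num.sqrt K.+1%:R in IH *; set b := Num.sqrt K.+2%:R.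
have a0 : 0 < a by rewrite sqrtr_gt0 ltr0n.
have b0 : 0 < b by rewrite sqrtr_gt0 ltr0n.
have ab : b ^+ 2 = a ^+ 2 + 1 by rewrite !sqr_sqrtr// -natr1.
suff : 2 * (b - a) <= a^-1 by lra.
rewrite -[leRHS]mul1r ler_pdivlMr//.
have : 0 <= (b - a) ^+ 2 by exact: sqr_ge0.
lra.
Qed.

End averages.

(** * Comparison of integrals without measurability, and Borel coordinates *)

Section measure_facts.
Context (d : measure_display) (Omega : measurableType d) (R : realType).

(** The integral of a nonnegative function is a supremum over simple functions below it, and this
    family grows with the function, measurable or not. *)
Lemma le_nonneg_integral (m : {measure set Omega -> \bar R})
    (f1 f2 : Omega -> \bar R) :
  (forall w, 0 <= f1 w)%E -> (forall w, f1 w <= f2 w)%E ->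
  (\int[m]_w f1 w <= \int[m]_w f2 w)%E.
Proof.
move=> f10 f12.
rewrite !ge0_integralTE//; last by move=> w; apply: le_trans (f12 w).
by apply: le_ereal_sup => _ [h /= hf <-]; exists h => //= w; exact: le_trans (f12 w).
Qed.

Lemma ae_le_nonneg_integral (m : {measure set Omega -> \bar R}) (f h : Omega -> R) :
  (forall w, 0 <= f w) -> m.-integrable setT (EFin \o h) ->
  {ae m, forall w, f w <= h w} ->
  (\int[m]_w (f w)%:E <= (\int[m]_w h w)%:E)%E.
Proof.
move=> f0 ih [N [mN mN0 fhN]].
have mh := measurable_int _ ih.
(* The majorant is [h] off the null set and [+oo] on it: it dominates [f] everywhere, is measurable,
   and has the integral of [h]. *)
pose h' : Omega -> \bar R :=
  (fun w => ((EFin \o h) \_ (~` N)) w + ((cst +oo%E : Omega -> \bar R) \_ N) w)%E.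
have mh1 : measurable_fun [set: Omega] ((EFin \o h) \_ (~` N) : Omega -> \bar R).
  by apply: (measurable_restrictT _ (measurableC mN)).1; exact: measurable_funS mh.
have mh2 : measurable_fun [set: Omega] ((cst +oo%E : Omega -> \bar R) \_ N : Omega -> \bar R).
  by apply: (measurable_restrictT _ mN).1; exact: measurable_cst.
have fh w : ~ N w -> f w <= h w.
  by move=> Nw; apply: contrapT => nfh; apply: Nw; exact: fhN.
have h1_ge0 w : (0 <= ((EFin \o h) \_ (~` N)) w)%E.
  rewrite patchE; case: ifPn => // /set_mem Nw.
  by rewrite lee_fin (le_trans (f0 w))// fh.
have h2_ge0 w : (0 <= ((cst +oo%E : Omega -> \bar R) \_ N) w)%E.
  by rewrite patchE; case: ifPn => // _; rewrite leey.
apply: le_trans (@le_nonneg_integral m _ h' _ _) _.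
- by move=> w; rewrite lee_fin.
- move=> w; rewrite /h' !patchE in_setC; have [wN|wN] := boolP (w \in N).
    by rewrite /= add0e leey.
  by rewrite /= adde0 lee_fin fh//; rewrite notin_setE in wN.
rewrite ge0_integralD// -!integral_mkcond.
rewrite [X in (_ + X)%E](_ : _ = 0%E) ?adde0; last first.
  by rewrite integral_cst// mN0 mule0.
rewrite fineK ?(integrable_fin_num measurableT ih)//.
by rewrite (negligible_integral mN measurableT ih mN0) setTD.
Qed.

Lemma measurable_coord n (i : 'I_n) :
  measurable_fun [set: borelV R n] (fun v : borelV R n => (v : 'rV[R]_n) 0 i).
Proof.
apply: (measurability _ (RGenOpens.measurableE R)).
move=> _ [_ [a [b ->]] <-]; rewrite setTI; apply: sub_sigma_algebra => /=.
have /continuousP := @coord_continuous R 1 n 0 i; apply.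
exact: itv_open.
Qed.

End measure_facts.

(** * Conditional expectation, independence and almost sure bounds *)

Section probability_facts.
Context (d : measure_display) (Omega : measurableType d) (R : realType).
Variable P : probability Omega R.

Lemma integrable_mul_bounded (W U : Omega -> R) (B : R) :
  P.-integrable setT (EFin \o W) -> measurable_fun [set: Omega] U ->
  (forall w, `|U w| <= B) -> P.-integrable setT (EFin \o (W \* U)).
Proof.
move=> iW mU UB.
have := @integrableMl _ _ _ P setT measurableT (EFin \o W) U iW mU.
have bU : [bounded U x | x in [set: Omega]].
  by exists B; split; [exact: num_real|move=> M BM w _; exact: le_trans (UB w) (ltW BM)].
by move=> /(_ bU); apply: eq_integrable => // w _; rewrite /= EFinM.
Qed.

(* Peeling off the leading binary digit of U, [U = 1_{U >= 1/2} / 2 + U' / 2],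
   leaves another [0, 1]-valued function U' of U and halves the bound. *)
Lemma integral_orthogonal_dyadic (W U : Omega -> R) N :
  P.-integrable setT (EFin \o W) -> measurable_fun [set: Omega] U ->
  (forall w, 0 <= U w <= 1) ->
  (forall B, measurable B -> \int[P]_(w in U @^-1` B) W w = 0) ->
  `|\int[P]_w (W w * U w)| <= 2^-1 ^+ N * \int[P]_w `|W w|.
Proof.
move=> iW; elim: N U => [|N IH] U mU U01 WU0.
  have iWU : P.-integrable setT (EFin \o (W \* U)).
    apply: (integrable_mul_bounded (B := 1)) => // w.
    by have /andP[U0 U1] := U01 w; rewrite ger0_norm.
  rewrite expr0 mul1r; apply: le_trans (le_normr_Rintegral measurableT iWU) _.
  apply: le_Rintegral => //; first exact: integrable_norm iWU.
    exact: integrable_norm iW.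
  move=> w _ /=; have /andP[U0 U1] := U01 w.
  by rewrite normrM (ger0_norm U0) ler_piMr.
pose A := `[2^-1, +oo[%classic : set R.
have mA : measurable A by exact: measurable_itv.
pose phi (r : R) := 2 * r - \1_A r.
have mphi : measurable_fun [set: R] phi.
  apply: measurable_funB; first exact: measurable_funM.
  exact: measurable_indic.
have U'01 w : 0 <= (phi \o U) w <= 1.
  have /andP[U0 U1] := U01 w; rewrite /phi /= indicE mem_setE in_itv/= andbT.
  by case: (lerP 2^-1 (U w)) => h /=; apply/andP; split; lra.
have mU' : measurable_fun [set: Omega] (phi \o U) by exact: measurableT_comp.
(* Preimages under [phi \o U] are preimages under [U], so orthogonality passes to the remaining
   digits. *)
have WU'0 B : measurable B -> \int[P]_(w in (phi \o U) @^-1` B) W w = 0.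
  move=> mB; rewrite comp_preimage; apply: WU0.
  by rewrite -[X in measurable X]setTI; exact: mphi.
have := IH _ mU' U'01 WU'0; rewrite exprS.
have i1 : P.-integrable setT (EFin \o (W \* (\1_A \o U))).
  apply: (integrable_mul_bounded (B := 1)) => // [|w].
    by apply: measurableT_comp => //; exact: measurable_indic.
  by rewrite /= indicE normr_nat lern1 leq_b1.
have i2 : P.-integrable setT (EFin \o (W \* (phi \o U))).
  apply: (integrable_mul_bounded (B := 1)) => // w.
  by have /andP[h0 h1] := U'01 w; rewrite ger0_norm.
(* The leading digit contributes the integral of [W] over the event [1/2 <= U], which is zero by
   hypothesis. *)
have e1 : \int[P]_w (W w * \1_A (U w)) = 0.
  rewrite -[RHS](WU0 A mA) [RHS]Rintegral_mkcond; apply: eq_Rintegral => w _.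
  by rewrite patchE -[w \in _]/(U w \in A) indicE; case: ifPn => _; rewrite ?mulr1 ?mulr0.
have -> : \int[P]_w (W w * U w) = 2^-1 * \int[P]_w (W w * (phi \o U) w).
  rewrite -RintegralZl//.
  transitivity (\int[P]_w (2^-1 * (W w * \1_A (U w)) + 2^-1 * (W w * (phi \o U) w))).
    by apply: eq_Rintegral => w _; rewrite /phi /=; field.
  rewrite RintegralD//.
  - by rewrite [X in X + _](RintegralZl _ measurableT i1) e1 mulr0 add0r.
  - exact: (integrableZl measurableT _ i1).
  - exact: (integrableZl measurableT _ i2).
move=> h; rewrite normrM ger0_norm ?invr_ge0// -mulrA.
by rewrite ler_pM2l ?invr_gt0.
Qed.

(** An affine map carries [U] into [0, 1], where the dyadic bound holds for every [N] and forces
    zero. Undoing the map costs a multiple of the integral of [W], which is zero too: take [B] to be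
    the whole line. *)
Lemma integral_orthogonal (W U : Omega -> R) (c : R) :
  P.-integrable setT (EFin \o W) -> measurable_fun [set: Omega] U ->
  (forall w, `|U w| <= c) ->
  (forall B, measurable B -> \int[P]_(w in U @^-1` B) W w = 0) ->
  \int[P]_w (W w * U w) = 0.
Proof.
move=> iW mU Uc WU0.
pose a := `|c| + 1; have a0 : 0 < a by rewrite ltr_wpDl.
pose phi (r : R) := (2 * a)^-1 * (r + a).
have mphi : measurable_fun [set: R] phi.
  by apply: measurable_funM => //; exact: measurable_funD.
have U'01 w : 0 <= (phi \o U) w <= 1.
  have : `|U w| <= a by rewrite (le_trans (Uc w))// (le_trans (ler_norm _))// lerDl.
  rewrite ler_norml => /andP[h0 h1]; rewrite /phi /= mulrC divr_ge0 ?mulr_ge0 ?(ltW a0)//=; last lra.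
  by rewrite ler_pdivrMr ?mulr_gt0// mul1r; lra.
have mU' : measurable_fun [set: Omega] (phi \o U) by exact: measurableT_comp.
have WU'0 B : measurable B -> \int[P]_(w in (phi \o U) @^-1` B) W w = 0.
  move=> mB; rewrite comp_preimage; apply: WU0.
  by rewrite -[X in measurable X]setTI; exact: mphi.
have z : \int[P]_w (W w * (phi \o U) w) = 0.
  apply/eqP; rewrite -normr_le0; apply/ler_addgt0Pl => e e0; rewrite addr0.
  pose I := \int[P]_w `|W w|.
  have I0 : 0 <= I by apply: Rintegral_ge0.
  have [N hN] : exists N, I / e < 2 ^+ N.
    exists (Num.bound (I / e)); apply: lt_le_trans (archi_boundP _) _.
      by rewrite divr_ge0// ltW.
    by rewrite -natrX ler_nat ltnW// ltn_expl.
  apply: le_trans (integral_orthogonal_dyadic N iW mU' U'01 WU'0) _.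
  rewrite exprVn mulrC ler_pdivrMr ?exprn_gt0// mulrC -ler_pdivrMr//.
  exact: ltW.
have W0 : \int[P]_w W w = 0 by rewrite -[RHS](WU0 setT measurableT) preimage_setT.
have i2 : P.-integrable setT (EFin \o (W \* (phi \o U))).
  apply: (integrable_mul_bounded (B := 1)) => // w.
  by have /andP[h0 h1] := U'01 w; rewrite ger0_norm.
transitivity (\int[P]_w ((2 * a) * (W w * (phi \o U) w) - a * W w)).
  by apply: eq_Rintegral => w _; rewrite /phi /=; field; rewrite gt_eqF.
rewrite RintegralB//; last 2 first.
- exact: (integrableZl measurableT _ i2).
- exact: (integrableZl measurableT _ iW).
by rewrite !RintegralZl// z W0 !mulr0 subrr.
Qed.

(** The pull-out property in integrated form: [Z - Y] integrates to zero over every set of [G], in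
    particular over preimages under [U], hence is orthogonal to [U]. *)
Lemma cond_exp_mul (G : set (set Omega)) (Y Z U : Omega -> R) (c : R) :
  is_cond_exp P G Y Z -> P.-integrable setT (EFin \o Y) ->
  measurable_fun [set: Omega] U -> (forall w, `|U w| <= c) ->
  (forall B, measurable B -> G (U @^-1` B)) ->
  \int[P]_w (Z w * U w) = \int[P]_w (Y w * U w).
Proof.
move=> [_ iZ ZY] iY mU Uc GU.
have iZU := integrable_mul_bounded iZ mU Uc.
have iYU := integrable_mul_bounded iY mU Uc.
apply/eqP; rewrite -subr_eq0 -RintegralB//; apply/eqP.
transitivity (\int[P]_w ((Z w - Y w) * U w)).
  by apply: eq_Rintegral => w _ /=; rewrite mulrBl.
apply: (integral_orthogonal (c := c)) => // [|B mB].
  exact: (integrableB measurableT iZ iY).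
have mUB : measurable (U @^-1` B) by rewrite -[X in measurable X]setTI; exact: mU.
rewrite RintegralB//.
- by rewrite /Rintegral ZY ?subrr//; exact: GU.
- exact: integrableS iZ.
- exact: integrableS iY.
Qed.

(** Independence identifies the joint law with the product of [mu] and the law of [Y2], as checked
    on rectangles; Tonelli then integrates the first variable with the second one frozen. *)
Lemma integral_indep_le (d1 d2 : measure_display) (T1 : measurableType d1)
    (T2 : measurableType d2) (mu : probability T1 R) (Y1 : {RV P >-> T1})
    (Y2 : Omega -> T2) (phi : T1 * T2 -> \bar R) (c : \bar R) :
  measurable_fun [set: Omega] Y2 -> measurable_fun [set: T1 * T2] phi ->
  (forall z, 0 <= phi z)%E ->
  (forall A, measurable A -> distribution P Y1 A = mu A) ->
  independent_rv P Y1 Y2 ->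
  (forall y, \int[mu]_s phi (s, y) <= c)%E ->
  (\int[P]_w phi (Y1 w, Y2 w) <= c)%E.
Proof.
move=> mY2 mphi phi0 Y1mu ind phic.
pose Y2' : {mfun Omega >-> T2} := mfun_Sub (mem_set mY2).
have mY : measurable_fun [set: Omega] (fun w => (Y1 w, Y2 w)).
  by apply: measurable_fun_pair.
pose Y : {mfun Omega >-> (T1 * T2)%type} := mfun_Sub (mem_set mY).
pose law2 := distribution P Y2'.
rewrite -(ge0_integral_distribution Y mphi phi0).
rewrite (eq_measure_integral (mu \x law2)%E); last first.
  move=> A mA _; apply/esym; apply: product_measure_unique => // B C mB mC.
  by apply: (etrans (ind B C mB mC)); congr (_ * _)%E; exact: Y1mu.
rewrite fubini_tonelli2//=.
apply: le_trans (_ : \int[law2]_y c <= _)%E.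
  by apply: le_nonneg_integral => // y; apply: integral_ge0.
by rewrite integral_cst//= probability_setT mule1.
Qed.

Lemma ae_bounded_integrable (h : Omega -> R) (c : R) :
  measurable_fun [set: Omega] h -> {ae P, forall w, `|h w| <= c} ->
  P.-integrable setT (EFin \o h).
Proof.
move=> mh hc; apply/integrableP; split; first exact/measurable_EFinP.
apply: le_lt_trans (_ : (`|c|%:E * P setT < +oo)%E); last first.
  by rewrite probability_setT mule1 ltry.
apply: integral_le_bound => //; first exact/measurable_EFinP.
by apply: filterS hc => w hw _ /=; rewrite lee_fin (le_trans hw)// ler_norm.
Qed.

Lemma ae_le_Rintegral (h1 h2 : Omega -> R) :
  P.-integrable setT (EFin \o h1) -> P.-integrable setT (EFin \o h2) ->
  {ae P, forall w, h1 w <= h2 w} ->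
  \int[P]_w h1 w <= \int[P]_w h2 w.
Proof.
move=> ih1 ih2 h12; rewrite -subr_ge0 -RintegralB//.
pose h w := h2 w - h1 w.
have ih : P.-integrable setT (EFin \o h) by exact: (integrableB measurableT ih2 ih1).
rewrite -lee_fin; apply: le_trans (ae_le_nonneg_integral (f := cst 0) _ ih _) => //.
  by rewrite integral0.
by apply: filterS h12 => w; rewrite subr_ge0.
Qed.

End probability_facts.

(** * Finite sums of integrable functions *)

Section integral_sums.
Context (d : measure_display) (Omega : measurableType d) (R : realType).
Variable P : probability Omega R.

Lemma integrable_EFinD (f h : Omega -> R) :
  P.-integrable setT (EFin \o f) -> P.-integrable setT (EFin \o h) ->
  P.-integrable setT (EFin \o (fun w => f w + h w)).
Proof. by move=> ih1 ih2; exact: (integrableD measurableT ih1 ih2). Qed.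

Lemma integrable_EFinZl (a : R) (f : Omega -> R) :
  P.-integrable setT (EFin \o f) ->
  P.-integrable setT (EFin \o (fun w => a * f w)).
Proof. by move=> ih1; exact: (integrableZl measurableT a ih1). Qed.

Lemma integrable_Rintegral_sum (I : eqType) (s : seq I) (f : I -> Omega -> R) :
  {in s, forall i, P.-integrable setT (EFin \o f i)} ->
  P.-integrable setT (EFin \o (fun w => \sum_(i <- s) f i w)) /\
  \int[P]_w (\sum_(i <- s) f i w) = \sum_(i <- s) \int[P]_w f i w.
Proof.
elim: s => [_|i s IH fs].
  have -> : (fun w => \sum_(i <- [::]) f i w) = cst 0.
    by apply/funext => w; rewrite big_nil.
  rewrite big_nil; split; last by rewrite Rintegral_cst// mul0r.
  exact: finite_measure_integrable_cst.
have [IHi IHe] : P.-integrable setT (EFin \o (fun w => \sum_(i <- s) f i w)) /\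
  \int[P]_w (\sum_(i <- s) f i w) = \sum_(i <- s) \int[P]_w f i w.
  by apply: IH => j js; apply: fs; rewrite inE js orbT.
have fi : P.-integrable setT (EFin \o f i) by apply: fs; rewrite mem_head.
have -> : (fun w => \sum_(j <- i :: s) f j w) =
    (fun w => f i w + \sum_(j <- s) f j w).
  by apply/funext => w; rewrite big_cons.
by rewrite RintegralD// IHe big_cons; split=> //; exact: integrable_EFinD.
Qed.

End integral_sums.

(** * Size of a single sampled gradient *)

Section expectation_bounds.
Context (R : realType) (n : nat) (d : measure_display) (Omega : measurableType d)
  (P : probability Omega R) (d' : measure_display) (Xi : measurableType d')
  (mu : probability Xi R) (X : set 'rV[R]_n) (gradf : 'rV[R]_n -> Xi -> 'rV[R]_n).
Hypothesis X_compact : compact X.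
Hypothesis gradf_measurable :
  measurable_fun ((X : set (borelV R n)) `*` [set: Xi])
    (fun p : borelV R n * Xi => (gradf p.1 p.2 : borelV R n)).

Lemma measurable_compact : measurable (X : set (borelV R n)).
Proof.
have cX : closed X by apply: compact_closed X_compact; exact: norm_hausdorff.
rewrite -[X]setCK; apply: measurableC; apply: sub_sigma_algebra => /=.
by rewrite openC.
Qed.

(** Joint measurability of [gradf] is given over [X] only, so the composition passes through the
    product of [X] and [Xi], where the pair [(y, s)] stays. *)
Lemma measurable_gradf_comp (y : Omega -> 'rV[R]_n) (s : Omega -> Xi) :
  measurable_fun [set: Omega] (y : Omega -> borelV R n) -> measurable_fun [set: Omega] s ->
  (forall w, X (y w)) ->
  measurable_fun [set: Omega] (fun w => gradf (y w) (s w) : borelV R n).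
Proof.
move=> my ms Xy.
apply: (measurable_comp (F := (X : set (borelV R n)) `*` [set: Xi])
  (f := fun p : borelV R n * Xi => (gradf p.1 p.2 : borelV R n))
  (g := fun w => (y w : borelV R n, s w))) => //.
- by apply: measurableX => //; exact: measurable_compact.
- by move=> _ [w _ <-] /=.
- exact: measurable_fun_pair.
Qed.

Variables (G1 Ginf : R).
Hypothesis hyp_i : forall y, X y -> ('E_mu[fun s => l1norm (gradf y s)] <= G1%:E)%E.
Hypothesis hyp_ii : {ae mu, forall s, forall y, X y -> `|gradf y s| <= Ginf}.

Section one_sample.
Variables (y : Omega -> 'rV[R]_n) (s : {RV P >-> Xi}).
Hypothesis my : measurable_fun [set: Omega] (y : Omega -> borelV R n).
Hypothesis Xy : forall w, X (y w).
Hypothesis s_distr : forall A, measurable A -> distribution P s A = mu A.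

(** The exceptional set of [hyp_ii] is uniform over [X], so its preimage under [s] also serves for
    the random point [y w]. *)
Lemma sample_gradf_bounded : {ae P, forall w, `|gradf (y w) (s w)| <= Ginf}.
Proof.
have [N [mN mN0 sub]] := hyp_ii.
exists (s @^-1` N); split.
- by rewrite -[X in measurable X]setTI; exact: measurable_funP.
- by rewrite -mN0 -s_distr.
- move=> w /= nb; apply: sub => /= h; apply: nb; exact: h.
Qed.

(** By independence the point may be frozen while the sample is integrated out, which reduces the
    claim to [hyp_i]. *)
Lemma sample_gradf_l1 : independent_rv P s (y : Omega -> borelV R n) -> 0 <= G1 ->
  (\int[P]_w (l1norm (gradf (y w) (s w)))%:E <= G1%:E)%E.
Proof.
move=> ind G10.
pose D : set (Xi * borelV R n) := [set: Xi] `*` (X : set (borelV R n)).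
have mD : measurable D by apply: measurableX => //; exact: measurable_compact.
pose phi0 : Xi * borelV R n -> R := fun z => l1norm (gradf z.2 z.1).
have mphi0 : measurable_fun D phi0.
  rewrite /phi0 /l1norm; apply: measurable_sum => i.
  apply: measurableT_comp => //.
  apply: (measurableT_comp (f := fun v : borelV R n => (v : 'rV[R]_n) 0 i)).
    exact: measurable_coord.
  apply: (measurable_comp (F := (X : set (borelV R n)) `*` [set: Xi])
    (f := fun p : borelV R n * Xi => (gradf p.1 p.2 : borelV R n))
    (g := fun z : Xi * borelV R n => (z.2, z.1))) => //.
  - by apply: measurableX => //; exact: measurable_compact.
  - by move=> _ [[t v] [_ Xv] <-].
  - apply: measurable_funTS; exact: measurable_swap.
(* Extension by zero outside [X] makes the integrand measurable on the whole product; there the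
   inner integral is 0, below [G1] by [0 <= G1]. *)
have mphi : measurable_fun [set: Xi * borelV R n] ((EFin \o phi0) \_ D : _ -> \bar R).
  by apply: (measurable_restrictT _ mD).1; exact/measurable_EFinP.
have -> : (\int[P]_w (l1norm (gradf (y w) (s w)))%:E =
    \int[P]_w ((EFin \o phi0) \_ D) (s w, y w : borelV R n))%E.
  apply: eq_integral => w _; rewrite patchE mem_set//.
  by split=> //=; exact: Xy.
apply: (integral_indep_le (mu := mu)) => //.
- move=> z; rewrite patchE; case: ifPn => // _.
  by rewrite lee_fin /phi0 sumr_ge0.
- move=> v; have [Xv|Xv] := pselect (X v).
    rewrite (eq_integral (fun t => (l1norm (gradf v t))%:E)).
      by have := hyp_i Xv; rewrite unlock.
    by move=> t _; rewrite patchE mem_set.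
  rewrite (eq_integral (fun=> 0%E)) ?integral0 ?lee_fin//.
  by move=> t _; rewrite patchE memNset// => -[].
Qed.

End one_sample.

Lemma G1_ge0 y : X y -> 0 <= G1.
Proof.
move=> Xy; rewrite -lee_fin; apply: le_trans (hyp_i Xy).
by rewrite unlock; apply: integral_ge0 => s _; rewrite lee_fin sumr_ge0.
Qed.

(** With [Ginf] negative, the null set of [hyp_ii] would be all of [Xi], which has mass one. *)
Lemma Ginf_ge0 y : X y -> 0 <= Ginf.
Proof.
move=> Xy; rewrite leNgt; apply/negP => Ginf0.
have [N [mN mN0 sub]] := hyp_ii.
suff NT : N = setT by move: mN0; rewrite NT probability_setT => -[] /eqP; rewrite oner_eq0.
rewrite -subTset => s _; apply: sub => /= /(_ y Xy).
by apply/negP; rewrite -ltNge (lt_le_trans Ginf0).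
Qed.

End expectation_bounds.

(** * Expectations of the momentum and of the second-moment estimates *)

Section gradient_process.
Context (R : realType) (n : nat) (d : measure_display) (Omega : measurableType d)
  (P : probability Omega R).
Variables (g : nat -> Omega -> 'rV[R]_n) (G1 Ginf : R).
Hypothesis g_measurable : forall k, (1 <= k)%N -> forall i,
  measurable_fun [set: Omega] (fun w => g k w 0 i).
Hypothesis g_bounded : {ae P, forall w, forall k, (1 <= k)%N -> forall i,
  `|g k w 0 i| <= Ginf}.

Lemma integrable_grad k i : (1 <= k)%N ->
  P.-integrable setT (EFin \o (fun w => g k w 0 i)).
Proof.
move=> k1; apply: (ae_bounded_integrable (c := Ginf)); first exact: g_measurable.
by apply: filterS g_bounded => w; apply.
Qed.

Lemma integrable_grad_norm k i : (1 <= k)%N ->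
  P.-integrable setT (EFin \o (fun w => `|g k w 0 i|)).
Proof. by move=> k1; exact: integrable_norm (integrable_grad i k1). Qed.

Lemma integrable_grad_l1 k : (1 <= k)%N ->
  P.-integrable setT (EFin \o (fun w => l1norm (g k w))).
Proof.
by move=> k1; apply: (integrable_Rintegral_sum _).1 => i _; exact: integrable_grad_norm.
Qed.

Lemma integrable_apam_m_norm (b : R) k i :
  P.-integrable setT
    (EFin \o (fun w => apam_m b (fun j => map_mx Num.norm (g j w)) k 0 i)).
Proof.
elim: k => [|k IH].
  have -> : (fun w => apam_m b (fun j => map_mx Num.norm (g j w)) 0 0 i) = cst 0.
    by apply/funext => w; rewrite mxE.
  exact: finite_measure_integrable_cst.
have -> : (fun w => apam_m b (fun j => map_mx Num.norm (g j w)) k.+1 0 i) =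
  (fun w => b * apam_m b (fun j => map_mx Num.norm (g j w)) k 0 i +
     (1 - b) * `|g k.+1 w 0 i|).
  by apply/funext => w /=; rewrite !mxE.
apply: integrable_EFinD; apply: integrable_EFinZl => //.
exact: integrable_grad_norm.
Qed.

Lemma integrable_apam_m_l1 (b : R) k : P.-integrable setT
  (EFin \o (fun w => l1norm (apam_m b (fun j => map_mx Num.norm (g j w)) k))).
Proof.
apply: (integrable_Rintegral_sum _).1 => i _.
exact: integrable_norm (integrable_apam_m_norm b k i).
Qed.

(** On nonnegative vectors the l1 norm is additive, so its expectation obeys the averaging recursion
    of the momentum and stays below [G1]. *)
Lemma expectation_apam_m_l1 (b : R) k : 0 <= b <= 1 -> 0 <= G1 ->
  (forall k, (1 <= k)%N -> \int[P]_w l1norm (g k w) <= G1) ->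
  \int[P]_w l1norm (apam_m b (fun j => map_mx Num.norm (g j w)) k) <= G1.
Proof.
move=> b01 G10 EG1; have /andP[b0 b1] := b01.
pose q k w := l1norm (apam_m b (fun j => map_mx Num.norm (g j w)) k).
rewrite -/(\int[P]_w q k w); elim: k => [|k IH].
  rewrite (_ : \int[P]_w _ = 0)//.
  rewrite -[RHS](mul0r (fine (P setT))) -Rintegral_cst//.
  apply: eq_Rintegral => w _; rewrite /q /l1norm big1// => i _.
  by rewrite mxE normr0.
have qS w : q k.+1 w = b * q k w + (1 - b) * l1norm (g k.+1 w).
  rewrite /q /l1norm !mulr_sumr -big_split/=; apply: eq_bigr => i _.
  have q0 : 0 <= apam_m b (fun j => map_mx Num.norm (g j w)) k 0 i.
    by apply: apam_m_ge0 => // j; rewrite mxE.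
  rewrite /= !mxE (ger0_norm q0) ger0_norm//.
  by rewrite addr_ge0// mulr_ge0// subr_ge0.
have iq := integrable_apam_m_l1 b k.
have ig := @integrable_grad_l1 k.+1 isT.
have -> : \int[P]_w q k.+1 w = \int[P]_w (b * q k w + (1 - b) * l1norm (g k.+1 w)).
  by apply: eq_Rintegral => w _; exact: qS.
rewrite RintegralD//; try exact: integrable_EFinZl.
rewrite !RintegralZl//.
have h1 : b * \int[P]_w q k w <= b * G1 by apply: ler_wpM2l.
have h2 : (1 - b) * \int[P]_w l1norm (g k.+1 w) <= (1 - b) * G1.
  by apply: ler_wpM2l; rewrite ?subr_ge0// EG1.
lra.
Qed.

Lemma measurable_apam_vhat (b : R) k i :
  measurable_fun [set: Omega] (fun w => apam_vhat b (fun j => g j w) k 0 i).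
Proof.
have m0 : measurable_fun [set: Omega] (fun w : Omega => (0 : 'rV[R]_n) 0 i).
  by rewrite mxE; exact: measurable_cst.
have mv : forall k,
    measurable_fun [set: Omega] (fun w => apam_v b (fun j => g j w) k 0 i).
  elim=> [//|{}k IH]; rewrite (_ : (fun w => _) = (fun w =>
      b * apam_v b (fun j => g j w) k 0 i + (1 - b) * g k.+1 w 0 i ^+ 2)).
    apply: measurable_funD; apply: measurable_funM => //.
    by apply: measurable_funX; exact: g_measurable.
  by apply/funext => w; rewrite /= !mxE.
elim: k => [//|k IH]; rewrite (_ : (fun w => _) =
    (fun w => apam_vhat b (fun j => g j w) k 0 i) \max
    (fun w => apam_v b (fun j => g j w) k.+1 0 i)).
  exact: measurable_maxr.
by apply/funext => w; rewrite [LHS]mxE.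
Qed.

Lemma measurable_sqrt_vhat (b : R) k i : measurable_fun [set: Omega]
  (fun w => Num.sqrt (apam_vhat b (fun j => g j w) k 0 i)).
Proof.
apply: (measurableT_comp (f := @Num.sqrt R)); last exact: measurable_apam_vhat.
by apply: continuous_measurable_fun; exact: sqrt_continuous.
Qed.

Lemma ae_sqrt_vhat_le (b : R) k i : 0 <= b <= 1 -> 0 <= Ginf ->
  {ae P, forall w, Num.sqrt (apam_vhat b (fun j => g j w) k 0 i) <= Ginf}.
Proof.
move=> b01 G0; apply: filterS g_bounded => w gw.
by apply: sqrt_vhat_le => // j /andP[j1 _]; exact: gw.
Qed.

Lemma integrable_sqrt_vhat (b : R) k i : 0 <= b <= 1 -> 0 <= Ginf ->
  P.-integrable setT
    (EFin \o (fun w => Num.sqrt (apam_vhat b (fun j => g j w) k 0 i))).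
Proof.
move=> b01 G0; apply: (ae_bounded_integrable (c := Ginf)).
  exact: measurable_sqrt_vhat.
apply: filterS (ae_sqrt_vhat_le k i b01 G0) => w.
by rewrite ger0_norm ?sqrtr_ge0.
Qed.

Lemma expectation_sum_sqrt_vhat (b : R) k : 0 <= b <= 1 -> 0 <= Ginf ->
  \int[P]_w (\sum_i Num.sqrt (apam_vhat b (fun j => g j w) k 0 i)) <= n%:R * Ginf.
Proof.
move=> b01 G0.
rewrite (integrable_Rintegral_sum _).2; last first.
  by move=> i _; exact: integrable_sqrt_vhat.
apply: le_trans (_ : \sum_(i < n) Ginf <= _); last first.
  by rewrite sumr_const card_ord mulr_natl.
apply: ler_sum => i _.
apply: le_trans (_ : \int[P]_w Ginf <= _).
  apply: ae_le_Rintegral.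
  - exact: integrable_sqrt_vhat.
  - exact: finite_measure_integrable_cst.
  - exact: ae_sqrt_vhat_le.
rewrite Rintegral_cst//.
have -> : fine (P [set: Omega]) = 1 by rewrite probability_setT.
by rewrite mulr1.
Qed.

End gradient_process.

(** * Expected optimality gap for nonincreasing step sizes *)

Section apam_convergence.
Context (R : realType) (n : nat)
  (d : measure_display) (Omega : measurableType d) (P : probability Omega R)
  (d' : measure_display) (Xi : measurableType d') (mu : probability Xi R)
  (X : set 'rV[R]_n) (F : 'rV[R]_n -> R)
  (gradf : 'rV[R]_n -> Xi -> 'rV[R]_n).
Hypothesis X_convex : convex_set (X : set (convex_lmodType 'rV[R]_n)).
Hypothesis X_compact : compact X.
Hypothesis F_convex :
  convex_function ([set: 'rV[R]_n] : set (convex_lmodType 'rV[R]_n)) F.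
Hypothesis gradf_measurable :
  measurable_fun ((X : set (borelV R n)) `*` [set: Xi])
    (fun p : borelV R n * Xi => (gradf p.1 p.2 : borelV R n)).
Variables (beta1 beta2 : R) (alpha : nat -> R) (b : nat -> nat).
Hypothesis beta1_range : 0 <= beta1 < 1.
Hypothesis beta2_range : 0 <= beta2 < 1.
Hypothesis alpha_gt0 : forall k, (1 <= k)%N -> 0 < alpha k.
Hypothesis b_ge1 : forall k, (1 <= k)%N -> (1 <= b k)%N.
Variables (x : nat -> Omega -> 'rV[R]_n) (xi : nat -> nat -> {RV P >-> Xi}).
Hypothesis x_measurable : forall k, (1 <= k)%N ->
  measurable_fun [set: Omega] (x k : Omega -> borelV R n).
Hypothesis xi_distr : forall k i, (1 <= k)%N -> (1 <= i <= b k)%N ->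
  forall A, measurable A -> distribution P (xi k i) A = mu A.
Hypothesis xi_indep : forall k i, (1 <= k)%N -> (1 <= i <= b k)%N ->
  independent_rv P (xi k i) (x k : Omega -> borelV R n).
Notation g := (minibatch_grad gradf b (fun k i w => xi k i w) x).
Hypothesis x_apam : forall w,
  apam X beta1 beta2 alpha (fun k => g k w) (fun k => x k w).
Variables (G1 Ginf : R).
Hypothesis hyp_i : forall y, X y -> ('E_mu[fun s => l1norm (gradf y s)] <= G1%:E)%E.
Hypothesis hyp_ii : {ae mu, forall s, forall y, X y -> `|gradf y s| <= Ginf}.

Lemma iterate_in k w : (1 <= k)%N -> X (x k w).
Proof.
have [X1 Xmin] := x_apam w.
by case: k => // -[//|k] _; have [] := Xmin k.+1 isT.
Qed.

Lemma X_nonempty : exists y, X y.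
Proof.
(* Measurable types are pointed, so there is an outcome at which to evaluate the first iterate. *)
have [w _] : exists w : Omega, True by exists point.
by exists (x 1 w); exact: iterate_in.
Qed.

Lemma G1_nonneg : 0 <= G1.
Proof. by have [y Xy] := X_nonempty; exact: (G1_ge0 hyp_i Xy). Qed.

Lemma Ginf_nonneg : 0 <= Ginf.
Proof. by have [y Xy] := X_nonempty; exact: (Ginf_ge0 hyp_ii Xy). Qed.

Lemma minibatch_gradE k w i : g k w 0 i =
  (b k)%:R^-1 * \sum_(1 <= j < (b k).+1) gradf (x k w) (xi k j w) 0 i.
Proof. by rewrite /minibatch_grad mxE summxE. Qed.

Lemma measurable_sample_grad k j i : (1 <= k)%N ->
  measurable_fun [set: Omega] (fun w => gradf (x k w) (xi k j w) 0 i).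
Proof.
move=> k1; apply: (measurableT_comp (f := fun v : borelV R n => (v : 'rV[R]_n) 0 i)).
  exact: measurable_coord.
apply: (measurable_gradf_comp X_compact gradf_measurable) => // [|w].
  exact: x_measurable.
exact: iterate_in.
Qed.

Lemma minibatch_grad_measurable k : (1 <= k)%N -> forall i,
  measurable_fun [set: Omega] (fun w => g k w 0 i).
Proof.
move=> k1 i; rewrite (_ : (fun w => _) = (fun w => (b k)%:R^-1 *
    \sum_(1 <= j < (b k).+1) gradf (x k w) (xi k j w) 0 i)).
  apply: measurable_funM => //; apply: measurable_sum => j.
  exact: measurable_sample_grad.
by apply/funext => w; exact: minibatch_gradE.
Qed.

Lemma mean_le k (c : nat -> R) (G : R) : (1 <= k)%N ->
  (forall j, (1 <= j <= b k)%N -> c j <= G) ->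
  (b k)%:R^-1 * \sum_(1 <= j < (b k).+1) c j <= G.
Proof.
move=> k1 cG; rewrite ler_pdivrMl ?ltr0n ?b_ge1//.
apply: le_trans (_ : \sum_(1 <= j < (b k).+1) G <= _).
  by apply: ler_sum_nat => j; rewrite ltnS; exact: cG.
by rewrite sumr_const_nat subn1 mulr_natl.
Qed.

(** There are countably many pairs of iteration and sample, so one null set serves for all of
    them. *)
Lemma minibatch_grad_bounded : {ae P, forall w, forall k, (1 <= k)%N ->
  forall i, `|g k w 0 i| <= Ginf}.
Proof.
have gb : {ae P, forall w, forall k j, (1 <= k)%N -> (1 <= j <= b k)%N ->
    `|gradf (x k w) (xi k j w)| <= Ginf}.
  apply/ae_foralln => k; apply/ae_foralln => j.
  have [k1|k1] := boolP (1 <= k)%N; last by exact: filterE.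
  have [j1|j1] := boolP (1 <= j <= b k)%N; last by exact: filterE.
  have := sample_gradf_bounded hyp_ii (y := x k) (fun w => iterate_in w k1) (xi_distr k1 j1).
  by apply: filterS => w.
apply: filterS gb => w gw k k1 i; rewrite minibatch_gradE normrM ger0_norm ?invr_ge0//.
apply: le_trans (_ : (b k)%:R^-1 * \sum_(1 <= j < (b k).+1)
    `|gradf (x k w) (xi k j w) 0 i| <= _).
  by apply: ler_wpM2l; rewrite ?invr_ge0//; exact: ler_norm_sum.
apply: mean_le => // j jk; apply: le_trans (normr_coord_le _ _) _.
exact: gw.
Qed.

Lemma expectation_minibatch_l1 k : (1 <= k)%N ->
  \int[P]_w l1norm (g k w) <= G1.
Proof.
move=> k1.
pose L j w := l1norm (gradf (x k w) (xi k j w)).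
have iL j : (1 <= j <= b k)%N -> P.-integrable setT (EFin \o L j).
  move=> jk; apply: (integrable_Rintegral_sum _).1 => i _.
  apply: integrable_norm; apply: (ae_bounded_integrable (c := Ginf)).
    exact: measurable_sample_grad.
  have := sample_gradf_bounded hyp_ii (y := x k) (fun w => iterate_in w k1) (xi_distr k1 jk).
  by apply: filterS => w; apply: le_trans; exact: normr_coord_le.
have EL j : (1 <= j <= b k)%N -> \int[P]_w L j w <= G1.
  move=> jk; rewrite -lee_fin fineK; last exact: integrable_fin_num (iL _ jk).
  apply: (sample_gradf_l1 X_compact gradf_measurable hyp_i) => //.
  - exact: x_measurable.
  - by move=> w; exact: iterate_in.
  - exact: xi_distr.
  - exact: xi_indep.
  - exact: G1_nonneg.
have [iS ES] : P.-integrable setT (EFin \o (fun w => \sum_(1 <= j < (b k).+1) L j w)) /\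
    \int[P]_w (\sum_(1 <= j < (b k).+1) L j w) =
    \sum_(1 <= j < (b k).+1) \int[P]_w L j w.
  by apply: integrable_Rintegral_sum => j; rewrite mem_index_iota ltnS; exact: iL.
apply: le_trans (_ : \int[P]_w ((b k)%:R^-1 * \sum_(1 <= j < (b k).+1) L j w) <= _); last first.
  by rewrite RintegralZl// ES; exact: mean_le.
apply: le_Rintegral => //.
- exact: (integrable_grad_l1 minibatch_grad_measurable minibatch_grad_bounded).
- exact: integrable_EFinZl.
move=> w _; rewrite /l1norm exchange_big/= mulr_sumr; apply: ler_sum => i _.
rewrite minibatch_gradE normrM ger0_norm ?invr_ge0//.
by apply: ler_wpM2l; rewrite ?invr_ge0//; exact: ler_norm_sum.
Qed.

(** Provides the measurability that [cond_exp_mul] asks of the multiplier. *)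
Lemma history_coord k (y : 'rV[R]_n) i (B : set R) : (1 <= k)%N -> measurable B ->
  history x k ((fun w => (x k w - y) 0 i) @^-1` B).
Proof.
move=> k1 mB; apply: sub_sigma_algebra; exists k; first by rewrite /= k1 leqnn.
have mc : measurable_fun [set: borelV R n] (fun v : borelV R n => (v : 'rV[R]_n) 0 i - y 0 i).
  by apply: measurable_funB => //; exact: measurable_coord.
exists ((fun v : borelV R n => (v : 'rV[R]_n) 0 i - y 0 i) @^-1` B).
  by rewrite -[X in measurable X]setTI; exact: mc.
by rewrite setTI; apply/seteqP; split => w /=; rewrite !mxE.
Qed.

(** Both step-size rules are specializations of this bound, in which only the sum of the steps and
    the sum of their squares appear. *)
Lemma apam_expected_gap (xs : 'rV[R]_n) (Fstar Dinf : R) (K : nat) :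
  (forall k, (1 <= k)%N ->
     exists Z : Omega -> 'rV[R]_n,
       is_cond_expV P (history x k) (g k) Z /\
       {ae P, forall w, subdiff F (x k w) (Z w)}) ->
  X xs -> F xs = Fstar -> (forall y, X y -> Fstar <= F y) ->
  (forall y z, X y -> X z -> `|y - z| <= Dinf) ->
  (forall k, (1 <= k)%N -> alpha k.+1 <= alpha k) -> (0 < K)%N ->
  ('E_P[fun w => (F (weighted_avg beta1 alpha K (fun k => x k w)) - Fstar)%R] <=
    ((n%:R * Dinf ^+ 2 * Ginf +
       (\sum_(1 <= k < K.+1) alpha k ^+ 2) / (1 - beta1) ^+ 2 *
         (G1 / Num.sqrt (1 - beta2))) /
     (2 * (1 - beta1) * (\sum_(1 <= k < K.+1) alpha k)))%:E)%E.
Proof.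
move=> hyp_iii Xxs Fxs Fmin XD alpha_ni K0.
have /andP[b10 b11] := beta1_range; have /andP[b20 b21] := beta2_range.
have b1' : 0 < 1 - beta1 by rewrite subr_gt0.
have b1_01 : 0 <= beta1 <= 1 by rewrite b10 ltW.
have b2_01 : 0 <= beta2 <= 1 by rewrite b20 ltW.
set S := Num.sqrt (1 - beta2).
have S0 : 0 < S by rewrite sqrtr_gt0 subr_gt0.
have G10 := G1_nonneg; have Ginf0 := Ginf_nonneg.
have mg := minibatch_grad_measurable; have bg := minibatch_grad_bounded.
pose c := avg_weight beta1 alpha K.
pose W := \sum_(1 <= k < K.+1) c k.
pose A := \sum_(1 <= k < K.+1) alpha k.
have c0 k : (1 <= k <= K)%N -> 0 < c k.
  move=> kK; apply: lt_le_trans (avg_weight_ge beta1_range alpha_gt0 kK).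
  by apply: alpha_gt0; case/andP: kK.
have A0 : 0 < A.
  rewrite /A big_ltn// ltr_wpDr ?alpha_gt0// big_nat_cond sumr_ge0// => k.
  by rewrite andbT => /andP[/ltnW k1 _]; rewrite ltW// alpha_gt0.
have AW : A <= W.
  by apply: ler_sum_nat => k; rewrite ltnS => kK; exact: avg_weight_ge.
have W0 : 0 < W := lt_le_trans A0 AW.
(* One version of the conditional gradient is fixed for each [k]; index 0 gets the default value
   0. *)
have /choice[Z Zc] : forall k, exists Zk : Omega -> 'rV[R]_n, (1 <= k)%N ->
    is_cond_expV P (history x k) (g k) Zk /\
    {ae P, forall w, subdiff F (x k w) (Zk w)}.
  move=> k; have [k1|k1] := boolP (1 <= k)%N; last by exists (fun=> 0).
  by have [Zk hZk] := hyp_iii _ k1; exists Zk.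
have mU k i : (1 <= k)%N -> measurable_fun [set: Omega] (fun w => (x k w - xs) 0 i).
  move=> k1; rewrite (_ : (fun w => _) = (fun w => x k w 0 i - xs 0 i)).
    apply: measurable_funB => //.
    apply: (measurableT_comp (f := fun v : borelV R n => (v : 'rV[R]_n) 0 i)).
      exact: measurable_coord.
    exact: x_measurable.
  by apply/funext => w; rewrite !mxE.
have UD k i w : (1 <= k)%N -> `|(x k w - xs) 0 i| <= Dinf.
  move=> k1; apply: le_trans (normr_coord_le _ _) _; apply: XD => //.
  exact: iterate_in.
have igU k i : (1 <= k)%N ->
    P.-integrable setT (EFin \o (fun w => g k w 0 i * (x k w - xs) 0 i)).
  move=> k1; apply: (integrable_mul_bounded (B := Dinf)).
  - exact: integrable_grad mg bg _ _ k1.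
  - exact: mU.
  - by move=> w; exact: UD.
have iZU k i : (1 <= k)%N ->
    P.-integrable setT (EFin \o (fun w => Z k w 0 i * (x k w - xs) 0 i)).
  move=> k1; apply: (integrable_mul_bounded (B := Dinf)).
  - by have [/(_ i)[]] := Zc k k1.
  - exact: mU.
  - by move=> w; exact: UD.
have EZg k i : (1 <= k)%N ->
    \int[P]_w (Z k w 0 i * (x k w - xs) 0 i) =
    \int[P]_w (g k w 0 i * (x k w - xs) 0 i).
  move=> k1; have [/(_ i) Zki _] := Zc k k1.
  apply: (cond_exp_mul (c := Dinf) Zki).
  - exact: integrable_grad mg bg _ _ k1.
  - exact: mU.
  - by move=> w; exact: UD.
  - by move=> B mB; exact: history_coord.
(* [H Z] bounds the gap and [H g] is bounded by the regret; [EHZg] shows that their expectations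
   agree. *)
pose H (V : nat -> Omega -> 'rV[R]_n) w :=
  \sum_(1 <= k < K.+1) c k * dotv (V k w) (x k w - xs).
have EH (V : nat -> Omega -> 'rV[R]_n) : (forall k i, (1 <= k)%N -> P.-integrable setT
      (EFin \o (fun w => V k w 0 i * (x k w - xs) 0 i))) ->
    P.-integrable setT (EFin \o H V) /\
    \int[P]_w H V w = \sum_(1 <= k < K.+1) c k *
      \sum_i \int[P]_w (V k w 0 i * (x k w - xs) 0 i).
  move=> iV.
  have dV k : (1 <= k)%N ->
      P.-integrable setT (EFin \o (fun w => dotv (V k w) (x k w - xs))) /\
      \int[P]_w dotv (V k w) (x k w - xs) =
      \sum_i \int[P]_w (V k w 0 i * (x k w - xs) 0 i).
    by move=> k1; apply: integrable_Rintegral_sum => i _; exact: iV.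
  have [iS ES] : P.-integrable setT (EFin \o H V) /\ \int[P]_w H V w =
      \sum_(1 <= k < K.+1) \int[P]_w (c k * dotv (V k w) (x k w - xs)).
    apply: integrable_Rintegral_sum => k; rewrite mem_index_iota => /andP[k1 _].
    by apply: integrable_EFinZl; case: (dV k k1).
  split=> //; rewrite ES; apply: eq_big_nat => k /andP[k1 _].
  by have [idV EdV] := dV k k1; rewrite RintegralZl// EdV.
have [iHZ EHZ] := EH _ iZU; have [iHg EHg] := EH _ igU.
have EHZg : \int[P]_w H Z w = \int[P]_w H (fun k => g k) w.
  rewrite EHZ EHg; apply: eq_big_nat => k /andP[k1 _]; congr (_ * _).
  by apply: eq_bigr => i _; exact: EZg.
pose Q k w := l1norm (apam_m beta1 (fun j => map_mx Num.norm (g j w)) k).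
pose V w := \sum_i Num.sqrt (apam_vhat beta2 (fun j => g j w) K 0 i).
pose e k := 2^-1 * c k ^+ 2 / S.
have e0 k : 0 <= e k by rewrite /e divr_ge0 ?(ltW S0)// mulr_ge0 ?sqr_ge0.
have iQ k : P.-integrable setT (EFin \o Q k) := integrable_apam_m_l1 mg bg beta1 k.
have iV : P.-integrable setT (EFin \o V).
  apply: (integrable_Rintegral_sum _).1 => i _.
  exact: integrable_sqrt_vhat mg bg _ _ _ b2_01 Ginf0.
have [iSQ ESQ] : P.-integrable setT (EFin \o (fun w => \sum_(1 <= k < K.+1) e k * Q k w)) /\
  \int[P]_w (\sum_(1 <= k < K.+1) e k * Q k w) =
  \sum_(1 <= k < K.+1) \int[P]_w (e k * Q k w).
  by apply: integrable_Rintegral_sum => k _; exact: integrable_EFinZl.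
(* Expectation of the pathwise regret bound. *)
have EHg_le : (1 - beta1) * \int[P]_w H (fun k => g k) w <=
    2^-1 * Dinf ^+ 2 * (n%:R * Ginf) + \sum_(1 <= k < K.+1) e k * G1.
  rewrite -RintegralZl//.
  apply: le_trans (_ : \int[P]_w (2^-1 * Dinf ^+ 2 * V w +
      \sum_(1 <= k < K.+1) e k * Q k w) <= _).
    apply: le_Rintegral => //.
    - exact: integrable_EFinZl.
    - by apply: integrable_EFinD => //; exact: integrable_EFinZl.
    - move=> w _; apply: (apam_regret K X_convex beta1_range beta2_range
        alpha_gt0 (x_apam w) Xxs).
      by move=> y Xy; exact: XD.
  rewrite RintegralD//; last exact: integrable_EFinZl.
  rewrite RintegralZl// ESQ lerD//.
    apply: ler_wpM2l; first by rewrite mulr_ge0 ?sqr_ge0.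
    exact: expectation_sum_sqrt_vhat mg bg _ _ b2_01 Ginf0.
  apply: ler_sum => k _; rewrite RintegralZl//; apply: ler_wpM2l => //.
  apply: (expectation_apam_m_l1 mg bg) => //; exact: expectation_minibatch_l1.
have gap w : X (weighted_avg beta1 alpha K (fun k => x k w)) /\
    F (weighted_avg beta1 alpha K (fun k => x k w)) <=
    (\sum_(1 <= k < K.+1) c k * F (x k w)) / W.
  rewrite /W /weighted_avg -/c; case: (K) K0 c0 => // K' _ c0.
  apply: jensen_weighted_mean => // k /andP[k1 _]; exact: iterate_in.
rewrite unlock.
pose H' w := W^-1 * H Z w.
have iH' : P.-integrable setT (EFin \o H') by exact: integrable_EFinZl.
apply: le_trans (ae_le_nonneg_integral _ iH' _) _.
- by move=> w; rewrite subr_ge0; apply: Fmin; case: (gap w).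
(* Almost surely [H'] dominates the gap: Jensen's inequality, then the subgradient inequality at
   each iterate, tested at [xs]. *)
- have : {ae P, forall w, forall k, (1 <= k)%N -> subdiff F (x k w) (Z k w)}.
    apply/ae_foralln => k.
    have [k1|k1] := boolP (1 <= k)%N; last exact: filterE.
    by have [_] := Zc k k1; apply: filterS => w.
  apply: filterS => w subZ.
  have [_ /le_trans] := gap w; rewrite lerBlDr; apply.
  rewrite ler_pdivrMr// mulrDl /H' mulrAC mulVf ?gt_eqF// mul1r /W mulr_sumr -big_split/=.
  apply: ler_sum_nat => k /andP[k1 kK].
  rewrite [Fstar * _]mulrC -mulrDr ler_pM2l ?c0 ?k1//.
  have := subZ k k1 xs; rewrite Fxs !dotvBr; lra.
rewrite lee_fin /H' RintegralZl// EHZg.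
set I := \int[P]_w _ in EHg_le *; set T := n%:R * _ * _ + _.
have sum_e : \sum_(1 <= k < K.+1) e k * G1 <=
    2^-1 * ((\sum_(1 <= k < K.+1) alpha k ^+ 2) / (1 - beta1) ^+ 2 * (G1 / S)).
  rewrite !mulr_suml mulr_sumr; apply: ler_sum_nat => k /andP[k1 kK].
  have ck : c k ^+ 2 <= alpha k ^+ 2 / (1 - beta1) ^+ 2.
    rewrite -expr_div_n lerXn2r ?nnegrE ?divr_ge0 ?(ltW (alpha_gt0 k1)) ?(ltW b1')//.
      by rewrite ltW// c0// k1.
    exact: avg_weight_le.
  have -> : e k * G1 = 2^-1 * (c k ^+ 2 * (G1 / S)).
    by rewrite /e; field; rewrite gt_eqF.
  by rewrite ler_pM2l// ler_wpM2r// divr_ge0// ltW.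
have T0 : 0 <= T.
  rewrite addr_ge0//.
    by apply: mulr_ge0 => //; apply: mulr_ge0 => //; exact: sqr_ge0.
  apply: mulr_ge0; last by rewrite divr_ge0// ltW.
  apply: mulr_ge0; last by rewrite invr_ge0 sqr_ge0.
  by apply: sumr_ge0 => k _; exact: sqr_ge0.
have IT : (1 - beta1) * I <= 2^-1 * T by rewrite /T; lra.
apply: le_trans (_ : W^-1 * (T / (2 * (1 - beta1))) <= _).
  rewrite ler_pM2l ?invr_gt0// ler_pdivlMr ?mulr_gt0//; lra.
(* The total weight [W] is replaced by the smaller sum [A] of the step sizes, which uses that [T] is
   nonnegative. *)
rewrite [X in _ <= T * X]invfM [leRHS]mulrA [leLHS]mulrC.
apply: ler_wpM2l; last by rewrite lef_pV2.
by rewrite divr_ge0// mulr_ge0// ltW.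
Qed.

End apam_convergence.

Theorem theorem1 (R : realType) (n : nat)
  (* underlying probability space, and the law mu of xi *)
  (d : measure_display) (Omega : measurableType d) (P : probability Omega R)
  (d' : measure_display) (Xi : measurableType d') (mu : probability Xi R)
  (X : set 'rV[R]_n)
  (X_convex : convex_set (X : set (convex_lmodType 'rV[R]_n)))
  (X_compact : compact X)
  (f : 'rV[R]_n -> Xi -> R)
  (f_integrable : forall x, mu.-integrable setT (EFin \o f x))
  (F_convex : convex_function
     ([set: 'rV[R]_n] : set (convex_lmodType 'rV[R]_n)) (objective mu f))
  (Fstar : R) (Fstar_min : is_min_of (objective mu f @` X) Fstar)
  (Dinf : R)
  (Dinf_max : is_max_of [set `|x - y| | x in X & y in X] Dinf)
  (* the selected (sub)gradients *)
  (gradf : 'rV[R]_n -> Xi -> 'rV[R]_n)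
  (gradf_subgradient :
     forall x s, X x -> is_subgradient (fun y => f y s) x (gradf x s))
  (gradf_measurable :
     measurable_fun ((X : set (borelV R n)) `*` [set: Xi])
       (fun p : borelV R n * Xi => (gradf p.1 p.2 : borelV R n)))
  (* algorithm parameters *)
  (beta1 beta2 : R)
  (beta1_range : 0 <= beta1 < 1) (beta2_range : 0 <= beta2 < 1)
  (alpha : nat -> R) (alpha_gt0 : forall k, (1 <= k)%N -> 0 < alpha k)
  (b : nat -> nat) (b_ge1 : forall k, (1 <= k)%N -> (1 <= b k)%N)
  (* iterates, evaluation points and samples *)
  (x xhat : nat -> Omega -> 'rV[R]_n) (xi : nat -> nat -> {RV P >-> Xi})
  (x_measurable : forall k, (1 <= k)%N ->
     measurable_fun [set: Omega] (x k : Omega -> borelV R n))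
  (no_delay : forall k, (1 <= k)%N -> xhat k = x k)
  (xi_distr : forall k i, (1 <= k)%N -> (1 <= i <= b k)%N ->
     forall A, measurable A -> distribution P (xi k i) A = mu A)
  (xi_indep : forall k i, (1 <= k)%N -> (1 <= i <= b k)%N ->
     independent_rv P (xi k i) (xhat k : Omega -> borelV R n))
  (g := minibatch_grad gradf b (fun k i w => xi k i w) xhat)
  (x_apam : forall w,
     apam X beta1 beta2 alpha (fun k => g k w) (fun k => x k w))
  (G1 Ginf : R)
  (hyp_i : forall y, X y -> ('E_mu[fun s => l1norm (gradf y s)] <= G1%:E)%E)
  (hyp_ii : {ae mu, forall s, forall y, X y -> `|gradf y s| <= Ginf})
  (hyp_iii : forall k, (1 <= k)%N ->
     exists Z : Omega -> 'rV[R]_n,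
       is_cond_expV P (history x k) (g k) Z /\
       {ae P, forall w, subdiff (objective mu f) (xhat k w) (Z w)})
  (K : nat) (K_gt0 : (0 < K)%N)
  (xbar := fun w => weighted_avg beta1 alpha K (fun k => x k w)) :
  (forall a : R, 0 < a ->
     (forall k, (1 <= k)%N -> alpha k = a / Num.sqrt K%:R) ->
     ('E_P[fun w => (objective mu f (xbar w) - Fstar)%R] <=
       ((n%:R * Dinf ^+ 2 * Ginf +
           a ^+ 2 / (1 - beta1) ^+ 2 * (G1 / Num.sqrt (1 - beta2))) /
        (2 * a * Num.sqrt K%:R * (1 - beta1)))%R%:E)%E) /\
  (forall a : R, 0 < a ->
     (forall k, (1 <= k)%N -> alpha k = a / Num.sqrt k%:R) ->
     ('E_P[fun w => (objective mu f (xbar w) - Fstar)%R] <=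
       ((n%:R * Dinf ^+ 2 * Ginf +
           a ^+ 2 * (1 + ln K%:R) / (1 - beta1) ^+ 2 *
             (G1 / Num.sqrt (1 - beta2))) /
        (4 * a * (Num.sqrt (K.+1)%:R - 1) * (1 - beta1)))%R%:E)%E).
Proof.
have [[xs Xxs Fxs] Fmin] := Fstar_min.
have Fmin' y : X y -> Fstar <= objective mu f y by move=> Xy; apply: Fmin; exists y.
have XD y z : X y -> X z -> `|y - z| <= Dinf.
  by move=> Xy Xz; apply: Dinf_max.2; exists y => //; exists z.
(* The gradients are built from [xhat], so every fact about [x] is carried over to [xhat]; the two
   agree from index 1 on, where runs, histories and averages start. *)
have xhat_measurable k : (1 <= k)%N ->
    measurable_fun [set: Omega] (xhat k : Omega -> borelV R n).
  by move=> k1; rewrite no_delay//; exact: x_measurable.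
have xhat_apam w : apam X beta1 beta2 alpha (fun k => g k w) (fun k => xhat k w).
  have [Xx1 xmin] := x_apam w; split; first by rewrite no_delay.
  by move=> k k1; rewrite !no_delay//; exact: xmin.
have history_xhat k : history xhat k = history x k.
  congr (<<s _ >>); apply: eq_bigcupr => t /andP[t1 _].
  by rewrite no_delay.
have xbarE w : xbar w = weighted_avg beta1 alpha K (fun k => xhat k w).
  by apply: eq_big_nat => k /andP[k1 _]; rewrite no_delay.
have gap : (forall k, (1 <= k)%N -> alpha k.+1 <= alpha k) ->
  ('E_P[fun w => (objective mu f (xbar w) - Fstar)%R] <=
    ((n%:R * Dinf ^+ 2 * Ginf +
       (\sum_(1 <= k < K.+1) alpha k ^+ 2) / (1 - beta1) ^+ 2 *
         (G1 / Num.sqrt (1 - beta2))) /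
     (2 * (1 - beta1) * (\sum_(1 <= k < K.+1) alpha k)))%:E)%E.
  move=> alpha_ni.
  rewrite (_ : (fun w => _) = (fun w => (objective mu f
      (weighted_avg beta1 alpha K (fun k => xhat k w)) - Fstar)%R)); last first.
    by apply/funext => w; rewrite xbarE.
  apply: (apam_expected_gap X_convex X_compact F_convex gradf_measurable
    beta1_range beta2_range alpha_gt0 b_ge1 xhat_measurable xi_distr xi_indep
    xhat_apam hyp_i hyp_ii _ Xxs Fxs Fmin' XD alpha_ni K_gt0) => k k1.
  by have [Z [cZ subZ]] := hyp_iii k k1; exists Z; rewrite history_xhat.
have b1' : 0 < 1 - beta1 by rewrite subr_gt0; case/andP: beta1_range.
have sqrtK0 : 0 < Num.sqrt (K%:R : R) by rewrite sqrtr_gt0 ltr0n.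
have S0 : 0 <= Num.sqrt (1 - beta2) by exact: sqrtr_ge0.
have G10 := G1_ge0 hyp_i Xxs; have Ginf0 := Ginf_ge0 hyp_ii Xxs.
(* [s] bounds the sum of squared steps from above and [r] the sum of steps from below. *)
have bound (s r : R) : (forall k, (1 <= k)%N -> alpha k.+1 <= alpha k) ->
    \sum_(1 <= k < K.+1) alpha k ^+ 2 <= s ->
    0 < r -> r <= \sum_(1 <= k < K.+1) alpha k ->
    ('E_P[fun w => (objective mu f (xbar w) - Fstar)%R] <=
      ((n%:R * Dinf ^+ 2 * Ginf +
         s / (1 - beta1) ^+ 2 * (G1 / Num.sqrt (1 - beta2))) /
       (2 * r * (1 - beta1)))%:E)%E.
  move=> alpha_ni s_ge r0 r_le; apply: le_trans (gap alpha_ni) _; rewrite lee_fin.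
  have sum0 : 0 <= \sum_(1 <= k < K.+1) alpha k ^+ 2.
    by apply: sumr_ge0 => k _; exact: sqr_ge0.
  have A0 := lt_le_trans r0 r_le.
  apply: ler_pM.
  - apply: addr_ge0.
      by apply: mulr_ge0 => //; apply: mulr_ge0 => //; exact: sqr_ge0.
    by apply: mulr_ge0; [apply: divr_ge0 => //; exact: sqr_ge0|exact: divr_ge0].
  - by rewrite invr_ge0 !mulr_ge0// ltW.
  - rewrite lerD2l ler_wpM2r//; first exact: divr_ge0.
    by rewrite ler_wpM2r// invr_ge0 sqr_ge0.
  - by rewrite lef_pV2 ?posrE ?mulr_gt0// -!mulrA ler_pM2l// mulrC ler_pM2l.
split=> a a0 alphaE.
  (* Constant steps: [s = a^2] and [r = a * sqrt K], both attained exactly. *)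
  rewrite -[2 * a * _]mulrA; apply: bound.
  - by move=> k k1; rewrite !alphaE.
  - rewrite (eq_big_nat _ _ (F2 := fun=> a ^+ 2 / K%:R)) => [|k /andP[k1 _]].
      by rewrite sumr_const_nat subn1/= -[_ *+ K]mulr_natr divfK// pnatr_eq0 -lt0n.
    by rewrite alphaE// expr_div_n sqr_sqrtr.
  - exact: mulr_gt0.
  - rewrite (eq_big_nat _ _ (F2 := fun=> a / Num.sqrt K%:R)) => [|k /andP[k1 _]].
      rewrite sumr_const_nat subn1/= -(mulr_natr (a / _)).
      rewrite -[X in _ <= _ * X]sqr_sqrtr// expr2 mulrA divfK ?gt_eqF//.
    exact: alphaE.
(* Decaying steps: [s = a^2 * (1 + ln K)] and [r = 2 * a * (sqrt (K+1) - 1)], positive because [K]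
   is. *)
have -> : 4 * a * (Num.sqrt K.+1%:R - 1) = 2 * (a * (2 * (Num.sqrt K.+1%:R - 1))) by ring.
apply: bound.
- move=> k k1; rewrite !alphaE// ler_pM2l// lef_pV2 ?posrE ?sqrtr_gt0 ?ltr0n//.
  by rewrite ler_wsqrtr// ler_nat.
- rewrite (eq_big_nat _ _ (F2 := fun k => a ^+ 2 * (k%:R)^-1)) => [|k /andP[k1 _]].
    by rewrite -mulr_sumr ler_wpM2l ?sqr_ge0// sum_inv_le_1Dln.
  by rewrite alphaE// expr_div_n sqr_sqrtr.
- apply: mulr_gt0 => //; apply: mulr_gt0 => //.
  by rewrite subr_gt0 -[ltLHS]sqrtr1 ltr_sqrt ?ltr0n// ltr1n.
- rewrite (eq_big_nat _ _ (F2 := fun k => a * (Num.sqrt k%:R)^-1)) => [|k /andP[k1 _]].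
    by rewrite -mulr_sumr ler_wpM2l ?(ltW a0)// sum_inv_sqrt_ge.
  exact: alphaE.
Qed.
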